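(* Let $M$ be a connected submanifold (isometrically immersed) in $\mathbb{E}^m$. Then $M$ is a minimal submanifold of a hypersphere of $\mathbb{E}^m$ if and only if $M$ has conformal Laplace transformation and the mean curvature vector field of $M$ in $\mathbb{E}^m$ is parallel in the normal bundle.
   Context: Manifolds and immersions are smooth, connected and of positive dimension. $\Delta=-\operatorname{trace}\nabla^2$ is the Laplace operator of $M$, $x$ the position vector (immersion), $n=\dim M$. The Laplace map is $L:M\to\mathbb{E}^m$, $L(p)=(\Delta x)(p)=-nH(p)$ with $H=\frac1n\operatorname{trace}h$ the mean curvature vector; the Laplace transformation $\mathcal L:M\to L(M)$ is $L$ regarded as a map onto its image. $\mathcal L$ is conformal if there is a strictly positive function $\rho$ on $M$ with $\langle dL(X),dL(Y)\rangle=\rho^2\langle X,Y\rangle$ for all tangent vectors $X,Y$ at a common point. The hypersphere may have any center and radius. *)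

(* Defs.v *)
From HB Require Import structures.
From mathcomp Require Import all_boot all_order all_algebra.
From mathcomp Require Import all_classical all_reals all_analysis.

Set Implicit Arguments.
Unset Strict Implicit.
Unset Printing Implicit Defensive.

Import Order.TTheory GRing.Theory Num.Theory.
Import numFieldNormedType.Exports.
Local Open Scope classical_set_scope.
Local Open Scope ring_scope.

(* 'rV[R]_m carries the sup norm in the library, which serves here only for
   the topology and differentiation; Euclidean geometry goes through dotp. *)
Definition dotp (R : realType) (m : nat) (u v : 'rV[R]_m) : R :=
  \sum_(a < m) u 0 a * v 0 a.

Fixpoint Ck (R : realType) (V W : normedModType R) (k : nat) (U : set V)
    (f : V -> W) : Prop :=
  if k is k'.+1 then
    (forall u, U u -> differentiable f u) /\
    (forall v, Ck k' U (fun u => 'd f u v))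
  else forall u, U u -> {for u, continuous f}.

(* Meant for open U and finite-dimensional V. *)
Definition smooth_on (R : realType) (V W : normedModType R) (U : set V)
    (f : V -> W) : Prop :=
  forall k, Ck k U f.

Record chart (R : realType) (n : nat) (T : topologicalType) := Chart {
  cdom : set T;
  cimg : set 'rV[R]_n;
  coord : T -> 'rV[R]_n;
  param : 'rV[R]_n -> T;
  cdom_open : open cdom;
  cimg_open : open cimg;
  coord_cimg : forall p, cdom p -> cimg (coord p);
  param_cdom : forall u, cimg u -> cdom (param u);
  coordK : forall p, cdom p -> param (coord p) = p;
  paramK : forall u, cimg u -> coord (param u) = u;
  coord_continuous : {within cdom, continuous coord};
  param_continuous : {within cimg, continuous param} }.

(* The atlas need not be maximal.  chart_at p is a preferred chart around p;
   tangent vectors at p are represented by their components in chart_at p. *)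
Record manifold (R : realType) (n : nat) := Manifold {
  mcarrier :> topologicalType;
  _ : hausdorff_space mcarrier;
  _ : @second_countable mcarrier;
  atlas : set (chart R n mcarrier);
  chart_at : mcarrier -> chart R n mcarrier;
  chart_at_atlas : forall p, atlas (chart_at p);
  mem_chart_at : forall p, cdom (chart_at p) p;
  atlas_compatible : forall c d, atlas c -> atlas d ->
    smooth_on (cimg c `&` param c @^-1` cdom d) (coord d \o param c) }.

Section LocalGeometry.
Variables (R : realType) (n : nat).
Implicit Types (W : normedModType R) (G : 'rV[R]_n -> 'M[R]_n).

Definition partial W (i : 'I_n) (f : 'rV[R]_n -> W) (u : 'rV[R]_n) : W :=
  'D_(delta_mx 0 i) f u.

(* Christoffel symbol \Gamma^k_{ij} of the Levi-Civita connection of the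
   metric with components G. *)
Definition christoffel G (k i j : 'I_n) (u : 'rV[R]_n) : R :=
  2^-1 * \sum_(l < n) invmx (G u) k l *
    (partial i (fun v => G v j l) u + partial j (fun v => G v i l) u
     - partial l (fun v => G v i j) u).

(* (\nabla^2 f)(e_i, e_j) *)
Definition hessian G W (f : 'rV[R]_n -> W) (i j : 'I_n) (u : 'rV[R]_n) : W :=
  partial i (partial j f) u - \sum_(k < n) christoffel G k i j u *: partial k f u.

Definition trace_metric G W (u : 'rV[R]_n) (b : 'I_n -> 'I_n -> W) : W :=
  \sum_(i < n) \sum_(j < n) invmx (G u) i j *: b i j.

Definition laplacian G W (f : 'rV[R]_n -> W) (u : 'rV[R]_n) : W :=
  - trace_metric G u (fun i j => hessian G f i j u).

Variable m : nat.
Implicit Type y : 'rV[R]_n -> 'rV[R]_m.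

Definition induced_metric y (u : 'rV[R]_n) : 'M[R]_n :=
  \matrix_(i, j) dotp (partial i y u) (partial j y u).

(* Second fundamental form of y as a map into N, a submanifold of E^m given
   by its tangential projections P q : E^m -> T_q N.  The Levi-Civita
   connection of N is P composed with the flat one, so that by the formula
   of Gauss h(e_i, e_j) = P (D_i e_j) - \nabla_i e_j. *)
Definition second_ff (P : 'rV[R]_m -> 'rV[R]_m -> 'rV[R]_m) y (i j : 'I_n)
    (u : 'rV[R]_n) : 'rV[R]_m :=
  P (y u) (partial i (partial j y) u)
  - \sum_(k < n) christoffel (induced_metric y) k i j u *: partial k y u.

(* Component of w orthogonal to the span of the \partial_i y u. *)
Definition normal_part y (u : 'rV[R]_n) (w : 'rV[R]_m) : 'rV[R]_m :=
  w - trace_metric (induced_metric y) u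
        (fun i j => dotp w (partial j y u) *: partial i y u).

End LocalGeometry.

Section Submanifolds.
Variables (R : realType) (n m : nat) (M : manifold R n).
Implicit Types (x f : M -> 'rV[R]_m) (p : M) (X Y : 'rV[R]_n).

Definition in_chart f p : 'rV[R]_n -> 'rV[R]_m := f \o param (chart_at p).

Definition at_chart p : 'rV[R]_n := coord (chart_at p) p.

Definition dmap f p X : 'rV[R]_m := 'd (in_chart f p) (at_chart p) X.

Definition immersion x : Prop :=
  (forall c, atlas c -> smooth_on (cimg c) (x \o param c)) /\
  (forall p, injective (dmap x p)).

(* In what follows M carries the metric induced by x. *)

Definition laplace_map x p : 'rV[R]_m :=
  laplacian (induced_metric (in_chart x p)) (in_chart x p) (at_chart p).

Definition mean_curvature_in (P : 'rV[R]_m -> 'rV[R]_m -> 'rV[R]_m) x p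
    : 'rV[R]_m :=
  n%:R^-1 *: trace_metric (induced_metric (in_chart x p)) (at_chart p)
    (fun i j => second_ff P (in_chart x p) i j (at_chart p)).

Definition mean_curvature x : M -> 'rV[R]_m :=
  mean_curvature_in (fun _ v => v) x.

Definition conformal_laplace_transformation x : Prop :=
  exists rho : M -> R, (forall p, 0 < rho p) /\
    forall p X Y,
      dotp (dmap (laplace_map x) p X) (dmap (laplace_map x) p Y)
      = rho p ^+ 2 * dotp (dmap x p X) (dmap x p Y).

Definition normal_connection x (xi : M -> 'rV[R]_m) p X : 'rV[R]_m :=
  normal_part (in_chart x p) (at_chart p) (dmap xi p X).

Definition parallel_normal x (xi : M -> 'rV[R]_m) : Prop :=
  forall p X, normal_connection x xi p X = 0.

Definition hypersphere (c : 'rV[R]_m) (r : R) : set 'rV[R]_m :=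
  [set q | dotp (q - c) (q - c) = r ^+ 2].

Definition sphere_tangent_proj (c q v : 'rV[R]_m) : 'rV[R]_m :=
  v - (dotp v (q - c) / dotp (q - c) (q - c)) *: (q - c).

Definition minimal_in_hypersphere x : Prop :=
  exists (c : 'rV[R]_m) (r : R), 0 < r /\
    (forall p, hypersphere c r (x p)) /\
    (forall p, mean_curvature_in (sphere_tangent_proj c) x p = 0).

End Submanifolds.

(* Main.v *)
From HB Require Import structures.
Require Import Defs.
From mathcomp Require Import all_boot all_order all_algebra.
From mathcomp Require Import all_classical all_reals all_analysis.
From mathcomp Require Import ring lra.
Local Open Scope classical_set_scope.

(* Write x for the immersion, H for its mean curvature vector, A for the shape
   operator in the direction of H, so that dH = -dx A once H is parallel in the
   normal bundle, and L = -n H.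

   If x is minimal in a hypersphere of center q and radius r, then
   H = -(x - q)/r^2 and both properties are immediate.

   Conversely, conformality says A^2 = f I with f > 0.  Since |H|^2 is constant
   and tr A = n |H|^2 is a nonzero constant, differentiating A^2 = f I and taking
   the trace against A gives df = 0: up to a constant factor H is an isometric
   immersion with the same Levi-Civita connection as x.  Hence the Hessian of H
   is normal, equals -h(A., .), and the Gauss equations of x and H compare to
   |tr Hess H|^2 = f |tr h|^2 = f n^2 |H|^2.  As <tr Hess H, H> = -|dH|^2 = -n f,
   Cauchy-Schwarz yields f <= |H|^4, and then
   |dH + |H|^2 dx|^2 = n (f - |H|^4) <= 0.  So H + |H|^2 x is constant, which
   places x on a hypersphere in which it is minimal. *)

Set Implicit Arguments.
Unset Strict Implicit.
Unset Printing Implicit Defensive.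

Import Order.TTheory GRing.Theory Num.Theory.
Import numFieldNormedType.Exports.
Local Open Scope ring_scope.

(** * Smooth functions *)

Section SmoothFunctions.
Variables (R : realType) (V : normedModType R).
Implicit Types (W : normedModType R) (U : set V).

(** The decisive step is the double trace of the Gauss equations. It yields |tr Hess H|^2 - |Hess
    H|^2 = f (|tr h|^2 - |h|^2), and the full norms drop out by themselves, since Hess H = -h(A., .)
    together with A^2 = f I gives |Hess H|^2 = f |h|^2. No curvature tensor is introduced: the Gauss
    equations arise by differentiating once more the equality of Christoffel symbols, where the
    third derivatives cancel by symmetry. The other obstacle is that every geometric quantity at p
    is computed in the preferred chart of p, which may jump as p moves. Before H can be
    differentiated in a fixed chart, the trace of the Hessian has to be shown independent of charts.
    Here, as in the formula for Hess H, one device avoids the transformation laws: two normal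
    vectors that differ by a tangent vector are equal, so tangential terms never have to be
    computed. *)

Lemma near_differentiable W (f g : V -> W) (u : V) :
  (\near u, f u = g u) -> differentiable f u ->
  differentiable g u /\ 'd g u = 'd f u :> (V -> W).
Proof.
move=> fg df.
have /nbhs_singleton fgu := fg.
(* A continuous linear part with a small remainder gives both claims, because the differential is
   unique. *)
suff dg : continuous ('d f u) /\ (g \o shift u = cst (g u) + 'd f u +o_ 0 id).
  have e : 'd g u = 'd f u :> (V -> W) by apply: diff_unique; case: dg.
  by split=> //; apply/diff_locallyP; rewrite e.
split; first exact: diff_continuous.
have /diff_locallyP[_ /eqaddoP h] := df.
apply/eqaddoP => e e0; have := h e e0.
have fg0 : \forall x \near (0 : V), f (shift u x) = g (shift u x).
  by move: fg; rewrite (near_shift 0 u) subr0.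
move=> he; near=> x.
have -> : (g \o shift u - (cst (g u) + 'd f u)) x =
          (f \o shift u - (cst (f u) + 'd f u)) x.
  rewrite /= -!fctE /=; congr (_ - (_ + _)) => //.
  by apply/esym; near: x.
by near: x.
Unshelve. all: by end_near. Qed.

(** [Ck] speaks of directional derivatives as functions on all of [V], while the rules of calculus
    identify them on [U] only; the closure properties below pass through this lemma. *)
Lemma Ck_ext W U (f g : V -> W) k : open U -> (forall u, U u -> f u = g u) ->
  Ck k U f -> Ck k U g.
Proof.
move=> oU; elim: k f g => [|k IH] f g fg /=.
  move=> cf u Uu; have := cf u Uu; rewrite /prop_for /continuous_at fg //.
  apply: cvg_trans; apply: near_eq_cvg.
  by near=> v; apply: fg; near: v; exact: open_nbhs_nbhs.
have key u : U u -> differentiable f u ->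
    differentiable g u /\ 'd g u = 'd f u :> (V -> W).
  move=> Uu; apply: near_differentiable.
  by near=> v; apply: fg; near: v; exact: open_nbhs_nbhs.
move=> [df cf]; split=> [u Uu|v]; first by case: (key u Uu (df u Uu)).
apply: IH (cf v) => u Uu; by case: (key u Uu (df u Uu)) => _ ->.
Unshelve. all: by end_near. Qed.

Lemma Ck_le W U (f : V -> W) k : Ck k.+1 U f -> Ck k U f.
Proof.
elim: k f => [|k IH] f [df cf] /=.
  by move=> u Uu; exact/differentiable_continuous/df.
by split=> // v; apply: IH; exact: cf.
Qed.

Lemma Ck_cst W U (w : W) k : Ck k U (fun=> w : W).
Proof.
elim: k w => [|k IH] w /=; first by move=> u _; exact: cvg_cst.
split=> [u _|v]; first exact: differentiable_cst.
have -> : (fun u : V => 'd (fun=> w) u v) = (fun=> 0).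
  by apply/funext => u; have /(congr1 (fun h => h v)) := @diff_cst R V W w u.
exact: IH.
Qed.

Lemma CkD W U (f g : V -> W) k : open U -> Ck k U f -> Ck k U g ->
  Ck k U (fun u => f u + g u).
Proof.
move=> oU; elim: k f g => [|k IH] f g /=.
  by move=> cf cg u Uu; apply: continuousD; [exact: cf|exact: cg].
move=> [df cf] [dg cg]; split=> [u Uu|v].
  by apply: differentiableD; [exact: df|exact: dg].
apply: Ck_ext oU _ (IH _ _ (cf v) (cg v)) => u Uu.
exact: esym (congr1 (fun F => F v) (diffD (df u Uu) (dg u Uu))).
Qed.

Lemma CkN W U (f : V -> W) k : open U -> Ck k U f -> Ck k U (fun u => - f u).
Proof.
move=> oU; elim: k f => [|k IH] f /=.
  by move=> cf u Uu; apply: continuousN; exact: cf.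
move=> [df cf]; split=> [u Uu|v].
  by apply: differentiableN; exact: df.
apply: Ck_ext oU _ (IH _ (cf v)) => u Uu.
exact: esym (congr1 (fun F => F v) (diffN (df u Uu))).
Qed.

Lemma CkM U (f g : V -> R) k : open U -> Ck k U f -> Ck k U g ->
  Ck k U (fun u => f u * g u).
Proof.
move=> oU; elim: k f g => [|k IH] f g cf cg.
  by move=> u Uu; apply: continuousM; [exact: cf|exact: cg].
(* The product rule brings back [f] and [g] themselves, at the lower order. *)
have cf' := Ck_le cf; have cg' := Ck_le cg.
case: cf cg => [df cf] [dg cg]; split=> [u Uu|v].
  by apply: differentiableM; [exact: df|exact: dg].
apply: Ck_ext oU _ (CkD oU (IH _ _ cf' (cg v)) (IH _ _ cg' (cf v))) => u Uu.
exact: esym (congr1 (fun F => F v) (diffM (df u Uu) (dg u Uu))).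
Qed.

Lemma CkZl W U (f : V -> R) (w : W) k : open U -> Ck k U f ->
  Ck k U (fun u => f u *: w).
Proof.
move=> oU; elim: k f => [|k IH] f.
  by move=> cf u Uu; apply: cvgZr_tmp; exact: cf.
move=> [df cf]; split=> [u Uu|v].
  by apply: differentiableZl; exact: df.
apply: Ck_ext oU _ (IH _ (cf v)) => u Uu.
exact: esym (congr1 (fun F => F v) (diffZl w (df u Uu))).
Qed.

Lemma CkV U (f : V -> R) k : open U -> (forall u, U u -> f u != 0) ->
  Ck k U f -> Ck k U (fun u => (f u)^-1).
Proof.
move=> oU f0; elim: k => [|k IH] cf.
  by move=> u Uu; apply: continuousV; [exact: f0|exact: cf].
(* The derivative -f'/f^2 contains the inverse itself, which the induction hypothesis controls at
   order [k]. *)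
have IH' := IH (Ck_le cf).
case: cf => [df cf]; split=> [u Uu|v].
  by apply: differentiableV; [exact: df|exact: f0].
apply: Ck_ext oU _ (CkN oU (CkM oU (CkM oU IH' IH') (cf v))) => u Uu.
apply: etrans (esym (congr1 (fun F => F v) (diffV (df u Uu) (f0 u Uu)))).
by rewrite /= -expr2 exprVn -mulNr.
Qed.

Lemma Ck_sum W U (I : Type) (r : seq I) (P : pred I) (f : I -> V -> W) k :
  open U -> (forall i, P i -> Ck k U (f i)) ->
  Ck k U (fun u => \sum_(i <- r | P i) f i u).
Proof.
move=> oU cf; elim: r => [|i r IH].
  by apply: Ck_ext oU _ (Ck_cst U (0 : W) k) => u _; rewrite big_nil.
case: (boolP (P i)) => Pi.
  by apply: Ck_ext oU _ (CkD oU (cf i Pi) IH) => u _; rewrite big_cons Pi.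
by apply: Ck_ext oU _ IH => u _; rewrite big_cons (negbTE Pi).
Qed.

Lemma Ck_prod U (I : Type) (r : seq I) (P : pred I) (f : I -> V -> R) k :
  open U -> (forall i, P i -> Ck k U (f i)) ->
  Ck k U (fun u => \prod_(i <- r | P i) f i u).
Proof.
move=> oU cf; elim: r => [|i r IH].
  by apply: Ck_ext oU _ (Ck_cst U (1 : R) k) => u _; rewrite big_nil.
case: (boolP (P i)) => Pi.
  by apply: Ck_ext oU _ (CkM oU (cf i Pi) IH) => u _; rewrite big_cons Pi.
by apply: Ck_ext oU _ IH => u _; rewrite big_cons (negbTE Pi).
Qed.

Lemma diff_coord p q (f : V -> 'M[R]_(p, q)) (u : V) i j :
  differentiable f u ->
  differentiable (fun v => f v i j : R) u /\
  'd (fun v => f v i j : R) u = (fun v => 'd f u v i j) :> (V -> R).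
Proof.
move=> df.
have cl : linear (fun M : 'M[R]_(p, q) => M i j : R).
  by move=> a M N; rewrite !mxE.
pose clM := GRing.isLinear.Build _ _ _ _ _ cl.
pose L : {linear 'M[R]_(p, q) -> R} := HB.pack (fun M : 'M[R]_(p, q) => M i j : R) clM.
have cL : continuous L by exact: coord_continuous.
have dL : differentiable L (f u) by exact: linear_differentiable.
split; first exact: (differentiable_comp df dL).
have -> : (fun v => f v i j) = L \o f by [].
by rewrite (diff_comp df dL) diff_lin.
Qed.

Lemma Ck_coord p q U (f : V -> 'M[R]_(p, q)) k i j : open U ->
  Ck k U f -> Ck k U (fun u => f u i j : R).
Proof.
move=> oU; elim: k f => [|k IH] f.
  move=> cf u Uu; apply: (@continuous_comp _ _ _ f (fun M : 'M[R]_(p, q) => M i j)).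
    exact: cf.
  exact: coord_continuous.
move=> [df cf]; split=> [u Uu|v]; first by case: (diff_coord i j (df u Uu)).
apply: Ck_ext oU _ (IH _ (cf v)) => u Uu.
by case: (diff_coord i j (df u Uu)) => _ ->.
Qed.

Lemma Ck_mx p q U (f : V -> 'M[R]_(p, q)) k : open U ->
  (forall i j, Ck k U (fun u => f u i j : R)) -> Ck k U f.
Proof.
move=> oU cf.
have : Ck k U (fun u => \sum_(i < p) \sum_(j < q) f u i j *: (delta_mx i j : 'M[R]_(p, q))).
  by apply: Ck_sum => // i _; apply: Ck_sum => // j _; apply: CkZl.
by apply: Ck_ext => // u _; rewrite -matrix_sum_delta.
Qed.

End SmoothFunctions.

(** * Symmetry of second derivatives *)

Section SecondDerivatives.
Variables (R : realType) (V : normedModType R).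

Lemma is_derive_line (f : V -> R) (c v : V) (t : R) :
  differentiable f (c + t *: v) ->
  is_derive t 1 (fun s : R => f (c + s *: v)) ('d f (c + t *: v) v).
Proof.
move=> df.
have dl : is_diff t (fun s : R => c + s *: v) (fun s => s *: v).
  have -> : (fun s : R => c + s *: v) = cst c + (fun s : R => s *: v) by [].
  by apply: is_diff_eq; rewrite add0r.
have /= dc := @differentiable_comp _ _ _ _ _ f t (@ex_diff _ _ _ _ _ _ _ dl) df.
apply: DeriveDef; first exact: diff_derivable.
rewrite deriveE // (diff_comp (@ex_diff _ _ _ _ _ _ _ dl) df) /=.
by rewrite (@diff_val _ _ _ _ _ _ _ dl) scale1r.
Qed.

(** The mean value theorem applied to [phi], an increment in the direction [w] seen as a function of
    the displacement along [v], turns the second difference into [s] times a difference of two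
    values of [g] near [u]. Both are then replaced by first-order expansions of [g] at [u]. *)
Lemma second_difference (f : V -> R) (u v w : V) (e : R) : 0 < e ->
  (\forall x \near u, differentiable f x) ->
  differentiable (fun x => 'd f x v : R) u ->
  exists2 d : R, 0 < d & forall s, 0 < s -> s < d ->
    `| f (u + s *: w + s *: v) - f (u + s *: v) - (f (u + s *: w) - f u)
       - s ^+ 2 * 'd (fun x => 'd f x v : R) u w | <= e * s ^+ 2.
Proof.
move=> e0 ndf dg.
set g := (fun x => 'd f x v : R).
(* The displacements s w + xi v and xi v have norms adding up to at most s (|w| + 2 |v|), hence to
   at most s N; a relative error e / N in each expansion then costs at most e s. The summand 1 keeps
   [N] positive. *)
pose N := 2 * (`|v| + `|w|) + 1.
have N0 : 0 < N by rewrite /N; have := normr_ge0 v; have := normr_ge0 w; lra.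
have eN : 0 < e / N by rewrite divr_gt0.
have /diff_locallyP[_ /eqaddoP /(_ _ eN)] := dg.
move=> /nbhs_ballP[r1 /= r10 B1].
have /nbhs_ballP[r2 /= r20 B2] := ndf.
pose d := Num.min r1 r2 / N.
have d0 : 0 < d by rewrite /d divr_gt0 // lt_min r10.
exists d => // s s0 sd.
have small (h : V) : `|h| <= s * (`|v| + `|w|) -> `|h| < r1 /\ `|h| < r2.
  move=> hs; have : `|h| < Num.min r1 r2.
    apply: le_lt_trans hs _.
    have : s * N < Num.min r1 r2 by rewrite -ltr_pdivlMr.
    have vw : 0 <= s * (`|v| + `|w|) by rewrite mulr_ge0 // ?addr_ge0 // ltW.
    by rewrite /N mulrDr mulr1; lra.
  by rewrite lt_min => /andP[].
have rem (h : V) : `|h| <= s * (`|v| + `|w|) ->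
    `|g (u + h) - g u - 'd g u h| <= e / N * `|h|.
  move=> hs; have [h1 _] := small h hs.
  have : ball 0 r1 h by rewrite -ball_normE /= sub0r normrN.
  by move/B1 => /= B; rewrite -addrA -opprD [u + h]addrC; exact: B.
have dfh (h : V) : `|h| <= s * (`|v| + `|w|) -> differentiable f (u + h).
  move=> hs; have [_ h2] := small h hs; apply: B2.
  by rewrite -ball_normE /= opprD addrA subrr sub0r normrN.
have nv (x : R) : 0 <= x -> x <= s -> `|x *: v| <= s * `|v|.
  by move=> x0 xs; rewrite normrZ ger0_norm // ler_wpM2r.
have nw : `|s *: w| = s * `|w| by rewrite normrZ gtr0_norm.
have n1 (x : R) : 0 <= x -> x <= s -> `|s *: w + x *: v| <= s * (`|v| + `|w|).
  by move=> x0 xs; apply: le_trans (ler_normD _ _) _; rewrite nw mulrDr addrC lerD2r nv.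
have n2 (x : R) : 0 <= x -> x <= s -> `|x *: v| <= s * (`|v| + `|w|).
  move=> x0 xs; apply: le_trans (nv x x0 xs) _.
  by rewrite mulrDr lerDl mulr_ge0 // ltW.
pose phi (t : R) : R := f (u + s *: w + t *: v) - f (u + t *: v).
have dphi t : 0 <= t -> t <= s ->
    is_derive t 1 phi (g (u + s *: w + t *: v) - g (u + t *: v)).
  move=> t0 ts; rewrite /phi.
  have D1 : is_derive t 1 (fun t => f (u + s *: w + t *: v)) (g (u + s *: w + t *: v)).
    by apply: is_derive_line; rewrite -addrA; apply: dfh; exact: n1.
  have D2 : is_derive t 1 (fun t => f (u + t *: v)) (g (u + t *: v)).
    by apply: is_derive_line; apply: dfh; exact: n2.
  exact: is_deriveB.
have [x|x|xi] := @MVT R phi (fun t => g (u + s *: w + t *: v) - g (u + t *: v)) 0 s s0.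
- by rewrite in_itv /= => /andP[x0 xs]; apply: dphi; exact: ltW.
- apply: derivable_within_continuous => y; rewrite in_itv /= => /andP[y0 ys].
  exact: (@ex_derive _ _ _ _ _ _ _ (dphi y y0 ys)).
rewrite in_itv /= => /andP[/ltW xi0 /ltW xis].
rewrite /phi !scale0r !addr0 subr0 => ->.
have := rem _ (n1 _ xi0 xis); have := rem _ (n2 _ xi0 xis).
rewrite addrA.
have -> : 'd g u (s *: w + xi *: v) = s * 'd g u w + xi * 'd g u v :> R.
  by rewrite linearD !linearZ.
have -> : 'd g u (xi *: v) = xi * 'd g u v :> R by rewrite linearZ.
set a := g (u + xi *: v); set b := g (u + s *: w + xi *: v); set c := g u.
set dv := 'd g u v; set dw := 'd g u w => Ha Hb.
(* In the difference of the two remainders [c] and the terms in [dv] cancel, leaving b - a - s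
   dw. *)
have -> : (b - a) * s - s ^+ 2 * dw =
    s * ((b - c - (s * dw + xi * dv)) - (a - c - xi * dv)) by ring.
rewrite normrM gtr0_norm // mulrC expr2 mulrA ler_pM2r //.
apply: le_trans (ler_normB _ _) _.
apply: le_trans (lerD Hb Ha) _.
rewrite -mulrDr.
have -> : e * s = e / N * (s * N) by field; rewrite gt_eqF.
rewrite ler_pM2l //; apply: le_trans (lerD (n1 _ xi0 xis) (nv _ xi0 xis)) _.
have := mulr_ge0 (ltW s0) (normr_ge0 w).
rewrite /N; lra.
Qed.

(** Young's form of the theorem, with the first derivatives differentiable at the point [u]: one and
    the same second difference, symmetric in [v] and [w], approximates s^2 times either mixed
    derivative. *)
Lemma diff2_sym (f : V -> R) (u v w : V) :
  (\forall x \near u, differentiable f x) ->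
  differentiable (fun x => 'd f x v : R) u ->
  differentiable (fun x => 'd f x w : R) u ->
  'd (fun x => 'd f x v : R) u w = 'd (fun x => 'd f x w : R) u v.
Proof.
move=> ndf dv dw; apply/eqP; rewrite -subr_eq0 -normr_le0.
apply/ler_addgt0Pr => e e0; rewrite add0r.
have e20 : 0 < e / 2 by rewrite divr_gt0.
have [d1 d10 H1] := @second_difference f u v w _ e20 ndf dv.
have [d2 d20 H2] := @second_difference f u w v _ e20 ndf dw.
pose s := Num.min d1 d2 / 2.
have m0 : 0 < Num.min d1 d2 by rewrite lt_min d10.
have s0 : 0 < s by rewrite divr_gt0.
have sm : s < Num.min d1 d2 by rewrite /s; lra.
have [s1 s2] : s < d1 /\ s < d2 by move: sm; rewrite lt_min => /andP[].
have := H1 s s0 s1; have := H2 s s0 s2.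
rewrite [u + s *: v + s *: w]addrAC.
set X := 'd _ u w; set Y := 'd _ u v; set A := f _; set B := f _; set C := f _.
move=> K1 K2.
have s20 : 0 < s ^+ 2 by rewrite exprn_gt0.
rewrite -(ler_pM2l s20) -[X in X * `|_|]gtr0_norm // -normrM.
have -> : s ^+ 2 * (X - Y) = (A - B - (C - f u) - s ^+ 2 * Y) -
  (A - C - (B - f u) - s ^+ 2 * X) by ring.
apply: le_trans (ler_normB _ _) _; apply: le_trans (lerD K1 K2) _.
by rewrite -mulrDl -splitr mulrC.
Qed.

End SecondDerivatives.

(** * Dot product and partial derivatives *)

Section DotProduct.
Variables (R : realType) (m : nat).
Implicit Types (u v w : 'rV[R]_m).

Lemma dotpC u v : dotp u v = dotp v u.
Proof. by apply: eq_bigr => a _; rewrite mulrC. Qed.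

Lemma dotpDl u v w : dotp (u + v) w = dotp u w + dotp v w.
Proof. by rewrite -big_split; apply: eq_bigr => a _; rewrite mxE mulrDl. Qed.

Lemma dotpDr u v w : dotp w (u + v) = dotp w u + dotp w v.
Proof. by rewrite dotpC dotpDl !(dotpC w). Qed.

Lemma dotpZl (c : R) u v : dotp (c *: u) v = c * dotp u v.
Proof. by rewrite mulr_sumr; apply: eq_bigr => a _; rewrite mxE mulrA. Qed.

Lemma dotpZr (c : R) u v : dotp u (c *: v) = c * dotp u v.
Proof. by rewrite dotpC dotpZl dotpC. Qed.

Lemma dotpNl u v : dotp (- u) v = - dotp u v.
Proof. by rewrite -scaleN1r dotpZl mulN1r. Qed.

Lemma dotpNr u v : dotp u (- v) = - dotp u v.
Proof. by rewrite dotpC dotpNl dotpC. Qed.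

Lemma dotpBl u v w : dotp (u - v) w = dotp u w - dotp v w.
Proof. by rewrite dotpDl dotpNl. Qed.

Lemma dotpBr u v w : dotp w (u - v) = dotp w u - dotp w v.
Proof. by rewrite dotpDr dotpNr. Qed.

Lemma dotp0l u : dotp 0 u = 0.
Proof. by rewrite -(scale0r u) dotpZl mul0r. Qed.

Lemma dotp0r u : dotp u 0 = 0.
Proof. by rewrite dotpC dotp0l. Qed.

Lemma dotp_suml (I : Type) (r : seq I) (P : pred I) (F : I -> 'rV[R]_m) v :
  dotp (\sum_(i <- r | P i) F i) v = \sum_(i <- r | P i) dotp (F i) v.
Proof.
by apply: (big_morph (fun u => dotp u v)) => [x y|]; rewrite ?dotpDl ?dotp0l.
Qed.

Lemma dotp_sumr (I : Type) (r : seq I) (P : pred I) (F : I -> 'rV[R]_m) v :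
  dotp v (\sum_(i <- r | P i) F i) = \sum_(i <- r | P i) dotp v (F i).
Proof. by rewrite dotpC dotp_suml; apply: eq_bigr => i _; rewrite dotpC. Qed.

Lemma dotp_ge0 u : 0 <= dotp u u.
Proof. by apply: sumr_ge0 => a _; rewrite -expr2 sqr_ge0. Qed.

Lemma dotp_eq0 u : dotp u u = 0 -> u = 0.
Proof.
move=> /eqP; rewrite psumr_eq0 => [/allP h|a _]; last by rewrite -expr2 sqr_ge0.
apply/rowP => a; rewrite mxE; apply/eqP.
by have := h a (mem_index_enum a); rewrite /= mulf_eq0 orbb.
Qed.

Lemma dotp_CauchySchwarz u v : dotp u v ^+ 2 <= dotp u u * dotp v v.
Proof.
have [->|v0] := eqVneq v 0; first by rewrite !dotp0r expr0n mulr0.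
have vv : 0 < dotp v v.
  by rewrite lt_def dotp_ge0 andbT; apply: contra_neq v0; exact: dotp_eq0.
(* Up to the factor [dotp v v], this is the component of [u] orthogonal to [v]. *)
have := dotp_ge0 (dotp v v *: u - dotp u v *: v).
rewrite !(dotpBl, dotpBr, dotpZl, dotpZr) (dotpC v u) => h.
have {h} : 0 <= dotp v v * (dotp u u * dotp v v - dotp u v ^+ 2).
  by apply: le_trans h _; rewrite le_eqVlt; apply/orP; left; apply/eqP; ring.
by rewrite pmulr_rge0 // subr_ge0.
Qed.

End DotProduct.

(** * Calculus with partial derivatives on open sets of coordinates *)

Section PartialDerivatives.
Variables (R : realType) (n : nat).
Implicit Types (W : normedModType R) (U : set 'rV[R]_n).

Lemma partial_diff W (f : 'rV[R]_n -> W) u i : differentiable f u ->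
  partial i f u = 'd f u (delta_mx 0 i).
Proof. exact: deriveE. Qed.

Lemma diff_partial W (f : 'rV[R]_n -> W) u v : differentiable f u ->
  'd f u v = \sum_(i < n) v 0 i *: partial i f u.
Proof.
move=> df; rewrite [in LHS](row_sum_delta v) linear_sum.
by apply: eq_bigr => i _; rewrite linearZ partial_diff.
Qed.

Lemma eq_partial W U (f g : 'rV[R]_n -> W) u i : open U -> U u ->
  (forall v, U v -> f v = g v) -> partial i f u = partial i g u.
Proof.
move=> oU Uu fg; apply: near_eq_derive.
by near=> v; apply: fg; near: v; exact: open_nbhs_nbhs.
Unshelve. all: by end_near. Qed.

Lemma smooth_differentiable W U (f : 'rV[R]_n -> W) u :
  smooth_on U f -> U u -> differentiable f u.
Proof. by move=> /(_ 1%N)[df _]; exact: df. Qed.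

Lemma smooth_subset W (U V : set 'rV[R]_n) (f : 'rV[R]_n -> W) :
  V `<=` U -> smooth_on U f -> smooth_on V f.
Proof.
move=> VU sf k; elim: k f {sf}(sf k) => [|k IH] f /=.
  by move=> cf u /VU; exact: cf.
by move=> [df cf]; split=> [u /VU|v]; [exact: df | apply: IH; exact: cf].
Qed.

Lemma smooth_partial W U (f : 'rV[R]_n -> W) i : open U ->
  smooth_on U f -> smooth_on U (partial i f).
Proof.
move=> oU sf k; have [df cf] := sf k.+1.
by apply: Ck_ext oU _ (cf (delta_mx 0 i)) => u Uu; rewrite partial_diff //; exact: df.
Qed.

Lemma smooth_mx p q U (f : 'rV[R]_n -> 'M[R]_(p, q)) : open U ->
  (forall a b, smooth_on U (fun u => f u a b : R)) -> smooth_on U f.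
Proof. by move=> oU sf k; apply: Ck_mx => // a b; exact: sf. Qed.

Lemma smooth_coord p q U (f : 'rV[R]_n -> 'M[R]_(p, q)) a b : open U ->
  smooth_on U f -> smooth_on U (fun u => f u a b : R).
Proof. by move=> oU sf k; apply: Ck_coord => //; exact: sf. Qed.

Lemma smoothM U (f g : 'rV[R]_n -> R) : open U ->
  smooth_on U f -> smooth_on U g -> smooth_on U (fun u => f u * g u).
Proof. by move=> oU sf sg k; apply: CkM. Qed.

Lemma smoothD W U (f g : 'rV[R]_n -> W) : open U ->
  smooth_on U f -> smooth_on U g -> smooth_on U (fun u => f u + g u).
Proof. by move=> oU sf sg k; apply: CkD. Qed.

Lemma smoothN W U (f : 'rV[R]_n -> W) : open U ->
  smooth_on U f -> smooth_on U (fun u => - f u).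
Proof. by move=> oU sf k; apply: CkN. Qed.

Lemma smooth_cst W U (w : W) : smooth_on U (fun _ : 'rV[R]_n => w).
Proof. by move=> k; exact: Ck_cst. Qed.

Lemma smooth_sum W U (I : Type) (r : seq I) (P : pred I)
    (f : I -> 'rV[R]_n -> W) : open U ->
  (forall i, P i -> smooth_on U (f i)) ->
  smooth_on U (fun u => \sum_(i <- r | P i) f i u).
Proof. by move=> oU sf k; apply: Ck_sum => // i Pi; exact: sf. Qed.

Lemma smooth_prod U (I : Type) (r : seq I) (P : pred I)
    (f : I -> 'rV[R]_n -> R) : open U ->
  (forall i, P i -> smooth_on U (f i)) ->
  smooth_on U (fun u => \prod_(i <- r | P i) f i u).
Proof. by move=> oU sf k; apply: Ck_prod => // i Pi; exact: sf. Qed.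

Lemma smoothV U (f : 'rV[R]_n -> R) : open U ->
  (forall u, U u -> f u != 0) -> smooth_on U f ->
  smooth_on U (fun u => (f u)^-1).
Proof. by move=> oU f0 sf k; apply: CkV. Qed.

Lemma smooth_dotp m U (f g : 'rV[R]_n -> 'rV[R]_m) : open U ->
  smooth_on U f -> smooth_on U g -> smooth_on U (fun u => dotp (f u) (g u)).
Proof.
move=> oU sf sg; apply: smooth_sum => // a _.
by apply: smoothM => //; apply: smooth_coord.
Qed.

Lemma smooth_det p U (A : 'rV[R]_n -> 'M[R]_p) : open U ->
  (forall i j, smooth_on U (fun u => A u i j : R)) ->
  smooth_on U (fun u => \det (A u)).
Proof.
move=> oU sA; apply: smooth_sum => // s _; apply: smoothM => //.
  exact: smooth_cst.
by apply: smooth_prod.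
Qed.

(** Cramer's rule: an entry of the inverse is a cofactor divided by the determinant. *)
Lemma smooth_invmx p U (A : 'rV[R]_n -> 'M[R]_p) i j : open U ->
  (forall u, U u -> A u \in unitmx) ->
  (forall i j, smooth_on U (fun u => A u i j : R)) ->
  smooth_on U (fun u => invmx (A u) i j : R).
Proof.
move=> oU uA sA.
have : smooth_on U (fun u => (\det (A u))^-1 * cofactor (A u) j i).
  apply: smoothM => //.
    apply: smoothV => //; last exact: smooth_det.
    by move=> u /uA; rewrite unitmxE unitfE.
  apply: smoothM => //; first exact: smooth_cst.
  apply: smooth_det => // a b k.
  by apply: Ck_ext oU _ (sA (lift j a) (lift i b) k) => u _; rewrite !mxE.
move=> h k; apply: Ck_ext oU _ (h k) => u /uA uu.
by rewrite /invmx uu !mxE.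
Qed.

Lemma partial_coord p q (f : 'rV[R]_n -> 'M[R]_(p, q)) u i a b :
  differentiable f u ->
  partial i (fun v => f v a b : R) u = partial i f u a b.
Proof.
by move=> df; have [dc e] := diff_coord a b df; rewrite !partial_diff // e.
Qed.

Lemma partialD W (f g : 'rV[R]_n -> W) u i :
  differentiable f u -> differentiable g u ->
  partial i (fun v => f v + g v) u = partial i f u + partial i g u.
Proof. by move=> df dg; apply: deriveD; exact: diff_derivable. Qed.

Lemma partialM (f g : 'rV[R]_n -> R) u i :
  differentiable f u -> differentiable g u ->
  partial i (fun v => f v * g v) u = partial i f u * g u + f u * partial i g u.
Proof.
move=> df dg; have := @deriveM R _ f g u (delta_mx 0 i) (diff_derivable df) (diff_derivable dg).
move=> h; apply: etrans h _; rewrite addrC; congr (_ + _); exact: mulrC.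
Qed.

Lemma partial_cst W (w : W) (u : 'rV[R]_n) i : partial i (fun=> w) u = 0.
Proof. exact: derive_cst. Qed.

Lemma partialZ W (f : 'rV[R]_n -> W) (c : R) u i : differentiable f u ->
  partial i (fun v => c *: f v) u = c *: partial i f u.
Proof. by move=> df; apply: deriveZ; exact: diff_derivable. Qed.

Lemma differentiable_bigsum W (I : Type) (r : seq I) (f : I -> 'rV[R]_n -> W) u :
  (forall k, differentiable (f k) u) ->
  differentiable (fun v => \sum_(k <- r) f k v) u /\
  forall i, partial i (fun v => \sum_(k <- r) f k v) u = \sum_(k <- r) partial i (f k) u.
Proof.
move=> df; elim: r => [|k r [dr er]].
  have -> : (fun v => \sum_(k <- [::]) f k v) = (fun=> 0).
    by apply/funext => v; rewrite big_nil.
  by split=> [|i]; [exact: differentiable_cst | rewrite big_nil partial_cst].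
have -> : (fun v => \sum_(l <- k :: r) f l v) = (fun v => f k v + \sum_(l <- r) f l v).
  by apply/funext => v; rewrite big_cons.
split=> [|i]; first exact: (differentiableD (df k) dr).
by rewrite partialD // er big_cons.
Qed.

Lemma partial_sum W (I : Type) (r : seq I) (f : I -> 'rV[R]_n -> W) u i :
  (forall k, differentiable (f k) u) ->
  partial i (fun v => \sum_(k <- r) f k v) u = \sum_(k <- r) partial i (f k) u.
Proof. by move=> df; exact: (differentiable_bigsum r df).2. Qed.

Lemma differentiable_dotp m (f g : 'rV[R]_n -> 'rV[R]_m) u :
  differentiable f u -> differentiable g u ->
  differentiable (fun v => dotp (f v) (g v)) u.
Proof.
move=> df dg; apply: (differentiable_bigsum _ _).1 => a.
by apply: differentiableM; [have [] := diff_coord 0 a df|have [] := diff_coord 0 a dg].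
Qed.

Lemma partial_dotp m (f g : 'rV[R]_n -> 'rV[R]_m) u i :
  differentiable f u -> differentiable g u ->
  partial i (fun v => dotp (f v) (g v)) u =
  dotp (partial i f u) (g u) + dotp (f u) (partial i g u).
Proof.
move=> df dg.
have dfa a : differentiable (fun v => f v 0 a : R) u by have [] := diff_coord 0 a df.
have dga a : differentiable (fun v => g v 0 a : R) u by have [] := diff_coord 0 a dg.
rewrite /dotp partial_sum => [|a]; last exact: differentiableM.
rewrite -big_split; apply: eq_bigr => a _.
by rewrite partialM // !partial_coord.
Qed.

Lemma smoothZ m U (c : 'rV[R]_n -> R) (f : 'rV[R]_n -> 'rV[R]_m) : open U ->
  smooth_on U c -> smooth_on U f -> smooth_on U (fun u => c u *: f u).
Proof.
move=> oU sc sf; apply: smooth_mx => // a b k.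
apply: Ck_ext oU _ (smoothM oU sc (smooth_coord a b oU sf) k) => u _.
by rewrite mxE.
Qed.

Lemma differentiable_scale m (c : 'rV[R]_n -> R) (f : 'rV[R]_n -> 'rV[R]_m) u :
  differentiable c u -> differentiable f u ->
  differentiable (fun v => c v *: f v) u.
Proof.
move=> dc df.
have -> : (fun v => c v *: f v) =
    (fun v => \sum_(a < m) (c v * f v 0 a) *: (delta_mx 0 a : 'rV[R]_m)).
  apply/funext => v; rewrite [in LHS](row_sum_delta (f v)) scaler_sumr.
  by apply: eq_bigr => a _; rewrite scalerA.
apply: (differentiable_bigsum _ _).1 => a; apply: differentiableZl.
by apply: differentiableM => //; have [] := diff_coord 0 a df.
Qed.

Lemma partial_scale m (c : 'rV[R]_n -> R) (f : 'rV[R]_n -> 'rV[R]_m) u i :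
  differentiable c u -> differentiable f u ->
  partial i (fun v => c v *: f v) u = partial i c u *: f u + c u *: partial i f u.
Proof.
move=> dc df; apply/rowP => a.
rewrite -partial_coord; last exact: differentiable_scale.
have [dfa _] := diff_coord 0 a df.
rewrite !mxE -(partial_coord i 0 a df) -(partialM i dc dfa).
by congr (partial i _ u); apply/funext => v; rewrite mxE.
Qed.

Lemma partialC_scalar U (f : 'rV[R]_n -> R) u i j : open U -> U u -> smooth_on U f ->
  partial i (partial j f) u = partial j (partial i f) u.
Proof.
move=> oU Uu sf.
have df v : U v -> differentiable f v := smooth_differentiable sf.
have e k v : U v -> partial k f v = 'd f v (delta_mx 0 k).
  by move=> Uv; rewrite partial_diff //; exact: df.
rewrite (eq_partial i oU Uu (e j)) (eq_partial j oU Uu (e i)).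
have d2 w : differentiable (fun x => 'd f x w : R) u.
  by have [_ /(_ w)[h _]] := sf 2%N; exact: h.
rewrite !partial_diff //; apply: diff2_sym => //.
by near=> v; apply: df; near: v; exact: open_nbhs_nbhs.
Unshelve. all: by end_near. Qed.

Lemma partialC m U (f : 'rV[R]_n -> 'rV[R]_m) u i j : open U -> U u -> smooth_on U f ->
  partial i (partial j f) u = partial j (partial i f) u.
Proof.
move=> oU Uu sf; apply/rowP => a.
have sfk k := smooth_partial k oU sf.
have e k l : partial k (partial l f) u 0 a = partial k (partial l (fun v => f v 0 a : R)) u.
  rewrite -partial_coord; last exact: smooth_differentiable (sfk l) Uu.
  apply: eq_partial oU Uu _ => v Uv; rewrite partial_coord //.
  exact: smooth_differentiable sf Uv.
apply: etrans (e i j) (etrans _ (esym (e j i))).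
exact: (partialC_scalar i j oU Uu (smooth_coord 0 a oU sf)).
Qed.

End PartialDerivatives.

Local Opaque partial.

(** * Induced metric *)

Section GramMatrices.
Variables (R : realType) (n m : nat).
Implicit Types (J K : 'M[R]_(n, m)).

Lemma mul_trmx_dotp p (A B : 'M[R]_(p, m)) i j : (A *m B^T) i j = dotp (row i A) (row j B).
Proof. by rewrite !mxE; apply: eq_bigr => a _; rewrite !mxE. Qed.

(** A kernel vector w of J J^T satisfies |w J|^2 = w J J^T w^T = 0. *)
Lemma gram_unit J : (forall w : 'rV[R]_n, w *m J = 0 -> w = 0) -> J *m J^T \in unitmx.
Proof.
move=> inj; rewrite -row_free_unit -kermx_eq0; apply/eqP/row_matrixP => i.
rewrite row0; apply: inj; apply: dotp_eq0.
set w := row i _.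
have w0 : w *m (J *m J^T) = 0 by rewrite /w -row_mul mulmx_ker row0.
have : (w *m (J *m J^T) *m w^T) 0 0 = 0 by rewrite w0 mul0mx mxE.
rewrite mulmxA -(mulmxA (w *m J)) -trmx_mul mul_trmx_dotp.
by rewrite (_ : row 0 _ = w *m J) //; apply/rowP => a; rewrite !mxE.
Qed.

Lemma invmx_sym p (A : 'M[R]_p) : A^T = A -> (invmx A)^T = invmx A.
Proof. by rewrite trmx_inv => ->. Qed.

(** The trace is the squared norm of [K] measured by the metric of [J]. Without choosing an
    orthonormal frame, it is the sum of the squares of the entries of B = J^T G^-1 K, and J B = K
    recovers [K] from [B]. *)
Lemma gram_trace_le0 J K : J *m J^T \in unitmx ->
  \tr (invmx (J *m J^T) *m (K *m K^T)) <= 0 -> K = 0.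
Proof.
move=> uG; set G := J *m J^T in uG *.
have sG : (invmx G)^T = invmx G by apply: invmx_sym; rewrite /G trmx_mul trmxK.
pose B := J^T *m invmx G *m K.
have -> : \tr (invmx G *m (K *m K^T)) = \sum_i \sum_j B i j ^+ 2.
  have -> : \tr (invmx G *m (K *m K^T)) = \tr (B *m B^T).
    rewrite [RHS]mxtrace_mulC.
    have -> : B^T *m B = K^T *m (invmx G *m K).
      rewrite /B !trmx_mul trmxK sG !mulmxA -(mulmxA _ J) -/G.
      by rewrite -(mulmxA _ (invmx G) G) (mulVmx uG) mulmx1.
    by rewrite [RHS]mxtrace_mulC mulmxA.
  apply: eq_bigr => i _; rewrite mxE; apply: eq_bigr => j _.
  by rewrite [B^T _ _]mxE expr2.
move=> h.
have B0 : B = 0.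
  apply/matrixP => i j; rewrite [RHS]mxE; apply/eqP.
  have h0 : \sum_i \sum_j B i j ^+ 2 == 0.
    rewrite eq_le h /=; apply: sumr_ge0 => k _; apply: sumr_ge0 => l _.
    exact: sqr_ge0.
  move: h0; rewrite psumr_eq0 => [/allP h0|k _]; last first.
    by apply: sumr_ge0 => l _; exact: sqr_ge0.
  have := h0 i (mem_index_enum i); rewrite /= psumr_eq0 => [/allP h1|l _]; last exact: sqr_ge0.
  by have := h1 j (mem_index_enum j); rewrite /= sqrf_eq0.
have : J *m B = 0 by rewrite B0 mulmx0.
by rewrite /B !mulmxA -/G mulmxV // mul1mx.
Qed.

End GramMatrices.

Section InducedMetric.
Variables (R : realType) (n m : nat) (U : set 'rV[R]_n).
Hypothesis oU : open U.
Implicit Types (y z : 'rV[R]_n -> 'rV[R]_m).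

(** Vectors are rows, so [w *m jac y u] is the differential of [y] applied to [w], and the row space
    of [jac y u] is the tangent space. *)
Definition jac y u : 'M[R]_(n, m) := \matrix_(i, a) partial i y u 0 a.

Lemma row_jac y u i : row i (jac y u) = partial i y u.
Proof. by apply/rowP => a; rewrite !mxE. Qed.

Lemma mul_jac y u (w : 'rV[R]_n) : w *m jac y u = \sum_(i < n) w 0 i *: partial i y u.
Proof. by rewrite mulmx_sum_row; apply: eq_bigr => i _; rewrite row_jac. Qed.

Lemma induced_metric_jac y u : induced_metric y u = jac y u *m (jac y u)^T.
Proof. by apply/matrixP => i j; rewrite mul_trmx_dotp !row_jac mxE. Qed.

Lemma induced_metric_sym y u : (induced_metric y u)^T = induced_metric y u.
Proof. by rewrite induced_metric_jac trmx_mul trmxK. Qed.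

Lemma induced_metricC y u i j : induced_metric y u i j = induced_metric y u j i.
Proof. by rewrite -{1}induced_metric_sym mxE. Qed.

Lemma smooth_induced_metric y i j : smooth_on U y ->
  smooth_on U (fun u => induced_metric y u i j : R).
Proof.
move=> sy k.
apply: Ck_ext oU _ (smooth_dotp oU (smooth_partial i oU sy) (smooth_partial j oU sy) k).
by move=> u _; rewrite mxE.
Qed.

Lemma partial_induced_metric y u i j k : smooth_on U y -> U u ->
  partial k (fun v => induced_metric y v i j : R) u =
  dotp (partial k (partial i y) u) (partial j y u)
  + dotp (partial i y u) (partial k (partial j y) u).
Proof.
move=> sy Uu.
rewrite -partial_dotp; [|by apply: smooth_differentiable Uu; apply: smooth_partial..].
by apply: eq_partial oU Uu _ => v _; rewrite mxE.
Qed.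

Lemma koszul_algebra (yi yj yk yij yik yjk : 'rV[R]_m) :
  dotp yij yk = 2^-1 * (dotp yij yk + dotp yj yik + (dotp yij yk + dotp yi yjk)
                        - (dotp yik yj + dotp yi yjk)).
Proof. by rewrite [dotp yik yj]dotpC; field. Qed.

(** The left-hand side is the Christoffel symbol of the first kind. Expanding the derivatives of the
    metric gives six terms; symmetry of the second derivatives cancels four and identifies the other
    two. It serves for [H] as well as for [y]. *)
Lemma koszul y u i j k : smooth_on U y -> U u ->
  dotp (partial i (partial j y) u) (partial k y u) =
  2^-1 * (partial i (fun v => induced_metric y v j k : R) u
          + partial j (fun v => induced_metric y v i k : R) u
          - partial k (fun v => induced_metric y v i j : R) u).
Proof.
move=> sy Uu; rewrite !(partial_induced_metric _ _ _ sy Uu).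
rewrite (partialC j i oU Uu sy) (partialC k i oU Uu sy) (partialC k j oU Uu sy).
exact: koszul_algebra.
Qed.

Lemma partial3C y u i j k : smooth_on U y -> U u ->
  partial i (partial j (partial k y)) u = partial k (partial j (partial i y)) u.
Proof.
move=> sy Uu.
rewrite (partialC i j oU Uu (smooth_partial k oU sy)).
have -> : partial j (partial i (partial k y)) u = partial j (partial k (partial i y)) u.
  by apply: eq_partial oU Uu _ => v Uv; exact: (partialC i k oU Uv sy).
exact: (partialC j k oU Uu (smooth_partial i oU sy)).
Qed.

Section Immersed.
Variable y : 'rV[R]_n -> 'rV[R]_m.
Hypothesis sy : smooth_on U y.
Hypothesis imm : forall u, U u -> injective ('d y u).

Lemma jac_inj u (w : 'rV[R]_n) : U u -> w *m jac y u = 0 -> w = 0.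
Proof.
move=> Uu; rewrite mul_jac -diff_partial; last exact: smooth_differentiable Uu.
by rewrite -{1}(linear0 ('d y u)); exact: imm.
Qed.

Lemma induced_metric_unit u : U u -> induced_metric y u \in unitmx.
Proof.
by move=> Uu; rewrite induced_metric_jac; apply: gram_unit => w; exact: jac_inj.
Qed.

Lemma smooth_inv_metric i j : smooth_on U (fun u => invmx (induced_metric y u) i j : R).
Proof.
apply: smooth_invmx => // [u|k l]; first exact: induced_metric_unit.
exact: smooth_induced_metric.
Qed.

Lemma smooth_christoffel k i j : smooth_on U (christoffel (induced_metric y) k i j).
Proof.
apply: smoothM => //; first exact: smooth_cst.
apply: smooth_sum => // l _; apply: smoothM => //; first exact: smooth_inv_metric.
apply: smoothD => //; last first.
  by apply: smoothN => //; apply: smooth_partial => //; apply: smooth_induced_metric.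
by apply: smoothD => //; apply: smooth_partial => //; apply: smooth_induced_metric.
Qed.

Lemma smooth_hessian i j : smooth_on U (hessian (induced_metric y) y i j).
Proof.
apply: smoothD => //.
  by apply: smooth_partial => //; apply: smooth_partial.
apply: smoothN => //; apply: smooth_sum => // k _; apply: smoothZ => //.
  exact: smooth_christoffel.
exact: smooth_partial.
Qed.

(** Lowering the upper index cancels the inverse metric and leaves the symbol of the first kind,
    known from [koszul]. *)
Lemma christoffel_metric u i j l : U u ->
  \sum_(k < n) christoffel (induced_metric y) k i j u * induced_metric y u k l =
  dotp (partial i (partial j y) u) (partial l y u).
Proof.
move=> Uu.
pose c l := dotp (partial i (partial j y) u) (partial l y u).
have E k : christoffel (induced_metric y) k i j u =
    \sum_(l < n) invmx (induced_metric y u) k l * c l.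
  rewrite /christoffel mulr_sumr; apply: eq_bigr => p _.
  by rewrite /c (koszul i j p sy Uu) mulrCA.
under eq_bigr => k _ do rewrite E mulr_suml.
rewrite exchange_big /=.
transitivity (\sum_(p < n) (p == l)%:R * c p).
  apply: eq_bigr => p _.
  rewrite -(_ : (induced_metric y u *m invmx (induced_metric y u)) l p
                = (p == l)%:R).
    rewrite !mxE mulr_suml; apply: eq_bigr => k _.
    by rewrite (induced_metricC y u k l); ring.
  by rewrite mulmxV ?induced_metric_unit // mxE eq_sym.
rewrite (bigD1 l) //= eqxx mul1r big1 ?addr0 // => p /negbTE ->.
by rewrite mul0r.
Qed.

(** The Christoffel terms are exactly the tangential part of the second derivative, so the Hessian
    of [y] for its own metric is its second fundamental form. *)
Lemma hessian_normal u i j l : U u ->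
  dotp (hessian (induced_metric y) y i j u) (partial l y u) = 0.
Proof.
move=> Uu; rewrite dotpBl dotp_suml -(christoffel_metric i j l Uu); apply/eqP.
by rewrite subr_eq0; apply/eqP/eq_bigr => k _; rewrite dotpZl mxE.
Qed.

(** Final move in the identification of two Hessians: their difference is tangent and normal, hence
    orthogonal to itself. *)
Lemma tangent_normal_eq0 u (c : 'rV[R]_n) :
  (forall l, dotp (c *m jac y u) (partial l y u) = 0) -> c *m jac y u = 0.
Proof.
move=> h; apply: dotp_eq0; rewrite {2}mul_jac dotp_sumr big1 // => i _.
by rewrite dotpZr h mulr0.
Qed.

End Immersed.
End InducedMetric.

(** * Pointwise algebra of a conformal shape operator *)

Section ConformalAlgebra.
Variables (R : realType) (n m : nat).
Implicit Types (J K : 'M[R]_(n, m)) (T : 'M[R]_n).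

(** The symmetry of K J^T = T G expresses that [T] is self-adjoint; it gives J K^T = T G, so that K
    K^T = T J K^T = T T G. *)
Lemma shape_square J K T (f : R) : J *m J^T \in unitmx -> K = T *m J ->
  K *m K^T = f *: (J *m J^T) -> (K *m J^T)^T = K *m J^T -> T *m T = f%:M.
Proof.
move=> uG KT KK NN; set G := J *m J^T in uG KK.
have TG : T *m G = K *m J^T by rewrite /G mulmxA -KT.
have e : T *m T *m G = f *: G.
  have JK : J *m K^T = T *m G by rewrite TG -NN trmx_mul trmxK.
  by rewrite -KK {1}KT -!mulmxA JK.
have := congr1 (mulmx^~ (invmx G)) e.
by rewrite -scalemxAl mulmxK // mulmxV // scalemx1.
Qed.

(** Multiply by [T] and take traces: by cyclicity and T T = f each term on the left becomes f tr T',
    while the right-hand side becomes f' tr T. *)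
Lemma shape_square_derivative T (T' : 'M[R]_n) (f f' : R) : f != 0 ->
  T *m T = f%:M -> T' *m T + T *m T' = f'%:M -> \tr T' = 0 -> \tr T != 0 -> f' = 0.
Proof.
move=> f0 TT dTT tT' tT.
have := congr1 (fun A => \tr (A *m T)) dTT.
rewrite mulmxDl mxtraceD -mulmxA TT (mxtrace_mulC (T *m T')) mulmxA TT.
rewrite !(mul_mx_scalar, mul_scalar_mx) !mxtraceZ tT' !mulr0 addr0.
by move=> /esym/eqP; rewrite mulf_eq0 (negbTE tT) orbF => /eqP.
Qed.

(** The metric trace of the Gram matrix of K + a J is n f - 2 n a^2 + n a^2, which the bound on [f]
    makes nonpositive. It is applied with a = |H|^2. *)
Lemma shape_umbilic J K T (f a : R) : J *m J^T \in unitmx -> K = T *m J ->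
  K *m K^T = f *: (J *m J^T) -> (K *m J^T)^T = K *m J^T ->
  \tr T = - n%:R * a -> f <= a ^+ 2 -> K = - a *: J.
Proof.
move=> uG KT KK NN tT fa.
suff /eqP : K + a *: J = 0 by rewrite addr_eq0 scaleNr => /eqP.
apply: (gram_trace_le0 uG).
set G := J *m J^T in uG KK *.
have TG : T *m G = K *m J^T by rewrite /G mulmxA -KT.
have JK : J *m K^T = T *m G by rewrite TG -NN trmx_mul trmxK.
have -> : (K + a *: J) *m (K + a *: J)^T = f *: G + (2 * a) *: (T *m G) + a ^+ 2 *: G.
  rewrite linearD linearZ /= mulmxDl !mulmxDr -!scalemxAl -!scalemxAr KK JK -TG -/G.
  rewrite scalerA -expr2 addrA -(addrA (f *: G)) -scalerDl.
  by congr (_ + _ *: _ + _); ring.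
rewrite !mulmxDr !mxtraceD -!scalemxAr !mxtraceZ mulVmx // mxtrace1.
rewrite mxtrace_mulC mulmxK // tT.
have -> : f * n%:R + 2 * a * (- n%:R * a) + a ^+ 2 * n%:R = n%:R * (f - a ^+ 2) by ring.
by rewrite mulr_ge0_le0 // ?ler0n // subr_le0.
Qed.

(** Agrees with [trace_metric] when [P] is the inverse metric; an arbitrary [P] allows a change of
    basis to be moved into the contracting matrix. *)
Definition metric_contraction (P : 'M[R]_n) (b : 'I_n -> 'I_n -> 'rV[R]_m) : 'rV[R]_m :=
  \sum_(i < n) \sum_(j < n) P i j *: b i j.

Lemma contract_dotp (P : 'M[R]_n) (b : 'I_n -> 'I_n -> 'rV[R]_m) (w : 'rV[R]_m) :
  dotp (metric_contraction P b) w = \sum_(i < n) \sum_(j < n) P i j * dotp (b i j) w.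
Proof.
rewrite dotp_suml; apply: eq_bigr => i _; rewrite dotp_suml.
by apply: eq_bigr => j _; rewrite dotpZl.
Qed.

Lemma contract_outer (P : 'M[R]_n) (b : 'I_n -> 'I_n -> 'rV[R]_m) :
  dotp (metric_contraction P b) (metric_contraction P b) =
  \sum_(i < n) \sum_(j < n) \sum_(l < n) \sum_(k < n) P i j * P l k * dotp (b i j) (b l k).
Proof.
rewrite contract_dotp; apply: eq_bigr => i _; apply: eq_bigr => j _.
rewrite dotpC contract_dotp mulr_sumr; apply: eq_bigr => l _.
rewrite mulr_sumr; apply: eq_bigr => k _.
by rewrite [dotp (b l k) _]dotpC mulrA.
Qed.

(** This is the squared full norm of [b]. Written coordinate by coordinate as tr (B P B^T P^T), it
    turns the passage from [b] to [T] applied to [b] into a matrix product. *)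
Lemma contract_inner (P : 'M[R]_n) (b : 'I_n -> 'I_n -> 'rV[R]_m) :
  \sum_(i < n) \sum_(j < n) \sum_(l < n) \sum_(k < n) P i j * P l k * dotp (b i l) (b j k)
  = \sum_(a < m) \tr ((\matrix_(i, j) b i j 0 a) *m P
                      *m (\matrix_(i, j) b i j 0 a)^T *m P^T).
Proof.
(* The coordinate sum hidden in [dotp] is carried outwards past the four index sums. *)
under eq_bigr do under eq_bigr do under eq_bigr do
  (under eq_bigr do rewrite mulr_sumr; rewrite exchange_big /=).
under eq_bigr do under eq_bigr do rewrite exchange_big /=.
under eq_bigr do rewrite exchange_big /=.
rewrite exchange_big /=; apply: eq_bigr => a _.
apply: eq_bigr => i _; rewrite mxE; apply: eq_bigr => j _.
rewrite [P^T _ _]mxE mxE mulr_suml exchange_big /=; apply: eq_bigr => k _.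
rewrite !mxE !mulr_suml; apply: eq_bigr => l _; rewrite mxE.
by ring.
Qed.

(** The first hypothesis is T T = f, rewritten for the inverse metric [P] by self-adjointness. It
    makes the full norm [I2] scale by [f], and the Gauss hypothesis summed against P i j P l k then
    leaves the norms of the traces. *)
Lemma gauss_contraction (P T : 'M[R]_n) (f : R) (h S : 'I_n -> 'I_n -> 'rV[R]_m) :
  T^T *m P *m T = f *: P ->
  (forall i j, S i j = \sum_(a < n) T i a *: h a j) ->
  (forall i j l k, dotp (S i j) (S l k) - dotp (S i l) (S j k) =
     f * (dotp (h i j) (h l k) - dotp (h i l) (h j k))) ->
  dotp (metric_contraction P S) (metric_contraction P S) =
  f * dotp (metric_contraction P h) (metric_contraction P h).
Proof.
move=> TPT ST gauss; apply/eqP; rewrite -subr_eq0; apply/eqP.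
pose I2 (b : 'I_n -> 'I_n -> 'rV[R]_m) := \sum_(i < n) \sum_(j < n) \sum_(l < n) \sum_(k < n)
  P i j * P l k * dotp (b i l) (b j k) : R.
have IS : I2 S = f * I2 h.
  rewrite /I2 !contract_inner mulr_sumr; apply: eq_bigr => a _.
  have -> : (\matrix_(i, j) S i j 0 a) = T *m \matrix_(i, j) h i j 0 a.
    apply/matrixP => i j; rewrite !mxE ST summxE; apply: eq_bigr => k _.
    by rewrite !mxE.
  set B := (\matrix_(i, j) h i j 0 a).
  rewrite trmx_mul -!mulmxA mxtrace_mulC -!mulmxA.
  have -> : T^T *m (P^T *m T) = f *: P^T.
    by rewrite -linearZ /= -TPT !trmx_mul trmxK mulmxA.
  by rewrite -!scalemxAr mxtraceZ.
suff : dotp (metric_contraction P S) (metric_contraction P S) - I2 S =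
    f * (dotp (metric_contraction P h) (metric_contraction P h) - I2 h).
  by rewrite IS mulrBr => /(congr1 (+%R^~ (f * I2 h))); rewrite !subrK => ->; rewrite subrr.
rewrite !contract_outer /I2 -!sumrB mulr_sumr; apply: eq_bigr => i _.
rewrite -!sumrB mulr_sumr; apply: eq_bigr => j _.
rewrite -!sumrB mulr_sumr; apply: eq_bigr => l _.
rewrite -!sumrB mulr_sumr; apply: eq_bigr => k _.
by rewrite -!mulrBr gauss mulrCA.
Qed.

Lemma conformal_factor_le (f : R) (H K : 'rV[R]_m) : (0 < n)%N -> 0 < f ->
  dotp K H = - (n%:R * f) -> dotp K K = f * (n%:R ^+ 2 * dotp H H) ->
  f <= dotp H H ^+ 2.
Proof.
move=> n0 f0 KH KK; have := dotp_CauchySchwarz K H.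
rewrite KH KK sqrrN exprMn.
have -> : f * (n%:R ^+ 2 * dotp H H) * dotp H H = (n%:R ^+ 2 * f) * dotp H H ^+ 2 by ring.
have -> : n%:R ^+ 2 * f ^+ 2 = n%:R ^+ 2 * f * f by ring.
by rewrite ler_pM2l // mulr_gt0 // exprn_gt0 // ltr0n.
Qed.

End ConformalAlgebra.

(** * The local rigidity argument *)

Section ConformalMeanCurvature.
Variables (R : realType) (n m : nat) (U : set 'rV[R]_n).
Variables (y H : 'rV[R]_n -> 'rV[R]_m) (f : 'rV[R]_n -> R).
Hypothesis n0 : (0 < n)%N.
Hypothesis oU : open U.
Hypothesis sy : smooth_on U y.
Hypothesis sH : smooth_on U H.
Hypothesis imm : forall u, U u -> injective ('d y u).
Hypothesis Hmean : forall u, U u -> n%:R *: H u =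
  metric_contraction (invmx (induced_metric y u))
    (fun i j => hessian (induced_metric y) y i j u).
Hypothesis Hpar : forall u i, U u -> normal_part y u (partial i H u) = 0.
Hypothesis f_gt0 : forall u, U u -> 0 < f u.
Hypothesis Hconf : forall u i j, U u ->
  dotp (partial i H u) (partial j H u) = f u * induced_metric y u i j.

Let G := induced_metric y.
Let g' u := invmx (G u).
Let J := jac y.
Let K := jac H.
(* dH = T dy: up to the sign, T is the shape operator in the direction H. *)
Let T u : 'M[R]_n := K u *m (J u)^T *m g' u.
Let hs i j u := hessian (induced_metric y) y i j u.

Let unitG u : U u -> J u *m (J u)^T \in unitmx.
Proof. by move=> Uu; rewrite -induced_metric_jac; exact: (induced_metric_unit sy imm). Qed.

Let g'_sym u : (g' u)^T = g' u.
Proof. by apply: invmx_sym; exact: induced_metric_sym. Qed.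

Let dy u i : U u -> differentiable (partial i y) u.
Proof. by move=> Uu; exact: smooth_differentiable (smooth_partial i oU sy) Uu. Qed.
Let dH u i : U u -> differentiable (partial i H) u.
Proof. by move=> Uu; exact: smooth_differentiable (smooth_partial i oU sH) Uu. Qed.
Let dH0 u : U u -> differentiable H u.
Proof. by move=> Uu; exact: smooth_differentiable sH Uu. Qed.

(** * The Weingarten equation and the algebra of [T] *)

Lemma mean_curvature_normal u l : U u -> dotp (H u) (partial l y u) = 0.
Proof.
move=> Uu; have : dotp (n%:R *: H u) (partial l y u) = 0.
  rewrite Hmean // contract_dotp big1 // => i _; rewrite big1 // => j _.
  by rewrite (hessian_normal oU sy imm i j l Uu) mulr0.
rewrite dotpZl => /eqP; rewrite mulf_eq0 pnatr_eq0 -leqn0 leqNgt n0 /=.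
by move/eqP.
Qed.

Let KJ u i j : (K u *m (J u)^T) i j = dotp (partial i H u) (partial j y u).
Proof. by rewrite mul_trmx_dotp !row_jac. Qed.

(** Since [H] is parallel, [partial i H] equals its tangential part, whose components in the frame
    [partial a y] form row [i] of [T]. *)
Let KT u : U u -> K u = T u *m J u.
Proof.
move=> Uu; apply/row_matrixP => i; rewrite row_jac row_mul mul_jac.
have /eqP := Hpar i Uu; rewrite subr_eq0 => /eqP {1}->.
apply: eq_bigr => a _; rewrite mxE mxE scaler_suml; apply: eq_bigr => b _.
by rewrite scalerA KJ mulrC -/G -/(g' u) -{1}(g'_sym u) mxE.
Qed.

(** Weingarten's equation, obtained by differentiating the orthogonality of [H] and [partial j y].
    Its right-hand side is symmetric in [i] and [j], whence [KJ_sym]. *)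
Let KJ_hess u i j : U u ->
  dotp (partial i H u) (partial j y u) = - dotp (partial i (partial j y) u) (H u).
Proof.
move=> Uu; have : partial i (fun v => dotp (H v) (partial j y v)) u = 0.
  rewrite (eq_partial (g := fun=> 0) i oU Uu) ?partial_cst // => v Uv.
  exact: mean_curvature_normal.
rewrite partial_dotp; [|exact: dH0|exact: dy].
by move/eqP; rewrite addr_eq0 [dotp (H u) _]dotpC => /eqP.
Qed.

Let KJ_sym u : U u -> (K u *m (J u)^T)^T = K u *m (J u)^T.
Proof.
move=> Uu; apply/matrixP => i j; rewrite mxE.
apply: etrans (KJ u j i) _; apply: etrans (KJ_hess j i Uu) _; apply: esym.
apply: etrans (KJ u i j) _; apply: etrans (KJ_hess i j Uu) _.
by rewrite (partialC i j oU Uu sy).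
Qed.

Let KK u : U u -> K u *m (K u)^T = f u *: (J u *m (J u)^T).
Proof.
move=> Uu; rewrite -induced_metric_jac -induced_metric_jac; apply/matrixP => i j.
by rewrite [RHS]mxE mxE Hconf.
Qed.

Let TT u : U u -> T u *m T u = (f u)%:M.
Proof. by move=> Uu; exact: shape_square (unitG Uu) (KT Uu) (KK Uu) (KJ_sym Uu). Qed.

(** The trace of Weingarten's equation; the Christoffel terms of the Hessian are tangent and
    disappear against [H]. *)
Let trT u : U u -> \tr (T u) = - n%:R * dotp (H u) (H u).
Proof.
move=> Uu; rewrite mulNr -dotpZl Hmean // contract_dotp -sumrN.
apply: eq_bigr => i _; rewrite mxE -sumrN; apply: eq_bigr => j _.
rewrite KJ KJ_hess // -(g'_sym u) [X in _ * X]mxE mulNr mulrC dotpBl dotp_suml.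
rewrite [X in _ - X]big1 ?subr0 // => k _.
by rewrite dotpZl dotpC mean_curvature_normal // mulr0.
Qed.

Let HH1 u i : U u -> dotp (partial i H u) (H u) = 0.
Proof.
move=> Uu; rewrite -row_jac -/(K u) KT // row_mul mul_jac dotp_suml big1 // => a _.
by rewrite dotpZl dotpC mean_curvature_normal // mulr0.
Qed.

Lemma norm_mean_curvature_stationary u i : U u ->
  partial i (fun v => dotp (H v) (H v)) u = 0.
Proof.
move=> Uu; rewrite partial_dotp; [|exact: dH0|exact: dH0].
by rewrite [dotp (H u) _]dotpC HH1 // addr0.
Qed.

Let HH2 u i j : U u -> dotp (partial i (partial j H) u) (H u) = - (f u * G u i j).
Proof.
move=> Uu; have : partial i (fun v => dotp (partial j H v) (H v)) u = 0.
  rewrite (eq_partial (g := fun=> 0) i oU Uu) ?partial_cst // => v Uv; exact: HH1.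
rewrite partial_dotp; [|exact: dH|exact: dH0].
by rewrite [dotp (partial j H u) _]dotpC Hconf // => /eqP; rewrite addr_eq0 => /eqP.
Qed.

(** At a zero of [H], [HH2] would force f g_ii = 0, hence a vanishing [partial i y], against
    injectivity of the differential. *)
Lemma mean_curvature_neq0 u : U u -> 0 < dotp (H u) (H u).
Proof.
move=> Uu; rewrite lt_def dotp_ge0 andbT; apply/eqP => /dotp_eq0 H0.
pose i0 : 'I_n := Ordinal n0.
have := HH2 i0 i0 Uu; rewrite H0 dotp0r => /eqP; rewrite eq_sym oppr_eq0.
rewrite mulf_eq0 gt_eqF ?f_gt0 //= mxE => /eqP /dotp_eq0 e.
have : (delta_mx 0 i0 : 'rV[R]_n) *m J u = 0 by rewrite -rowE row_jac.
move/(jac_inj sy imm Uu)/rowP/(_ i0); rewrite !mxE !eqxx /= => /eqP.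
by rewrite oner_eq0.
Qed.

Let sT i j : smooth_on U (fun u => T u i j : R).
Proof.
have h : smooth_on U (fun u => \sum_(b < n)
    dotp (partial i H u) (partial b y u) * invmx (induced_metric y u) b j).
  apply: smooth_sum => // b _; apply: smoothM => //; last exact: smooth_inv_metric.
  by apply: smooth_dotp => //; apply: smooth_partial.
move=> k; apply: Ck_ext oU _ (h k) => u _.
by rewrite mxE; apply: eq_bigr => b _; rewrite KJ.
Qed.

Let dT u i j : U u -> differentiable (fun u => T u i j : R) u.
Proof. by move=> Uu; exact: smooth_differentiable (sT i j) Uu. Qed.

Let fT u i : U u -> (T u *m T u) i i = f u.
Proof. by move=> Uu; rewrite TT // mxE eqxx. Qed.

(** [f] is given without any regularity; it acquires it as a diagonal entry of T T. *)
Let df u : U u -> differentiable f u.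
Proof.
move=> Uu; pose i0 : 'I_n := Ordinal n0.
have h : smooth_on U (fun u => (T u *m T u) i0 i0).
  have h : smooth_on U (fun u => \sum_(a < n) T u i0 a * T u a i0).
    by apply: smooth_sum => // a _; apply: smoothM.
  by move=> k; apply: Ck_ext oU _ (h k) => v _; rewrite mxE.
have sf : smooth_on U f by move=> k; apply: Ck_ext oU _ (h k) => v; exact: fT.
exact: smooth_differentiable sf Uu.
Qed.

Lemma conformal_factor_stationary u k : U u -> partial k f u = 0.
Proof.
move=> Uu; pose T' : 'M[R]_n := \matrix_(i, j) partial k (fun v => T v i j : R) u.
have hT' a b : T' a b = partial k (fun v => T v a b : R) u by rewrite [LHS]mxE.
apply: (@shape_square_derivative R n (T u) T' (f u)).
- by rewrite gt_eqF // f_gt0.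
- exact: TT.
- apply/matrixP => i j.
  have e : partial k (fun v => \sum_(a < n) T v i a * T v a j) u = partial k f u *+ (i == j).
    have h v : U v -> \sum_(a < n) T v i a * T v a j = f v *+ (i == j).
      move=> Uv; have := congr1 (fun A : 'M[R]_n => A i j) (TT Uv).
      by rewrite mxE => ->; rewrite mxE.
    rewrite (eq_partial k oU Uu h); case: (i == j) => //=.
    by rewrite mulr0n partial_cst.
  rewrite [RHS]mxE -e partial_sum => [|a]; last by apply: differentiableM; exact: dT.
  rewrite [LHS]mxE [X in X + _]mxE [X in _ + X]mxE -big_split; apply: eq_bigr => a _.
  rewrite partialM; [|exact: dT|exact: dT].
  by rewrite (hT' i a) (hT' a j).
- transitivity (partial k (fun v => \sum_(i < n) T v i i) u).
    rewrite partial_sum => [|i]; last exact: dT.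
    by apply: eq_bigr => i _; rewrite mxE.
  rewrite (eq_partial k oU Uu (fun v Uv => trT Uv)).
  have e := partialZ (- n%:R) k (differentiable_dotp (dH0 Uu) (dH0 Uu)).
  by apply: etrans e _; rewrite norm_mean_curvature_stationary // scaler0.
- rewrite trT // mulf_eq0 oppr_eq0 pnatr_eq0 -leqn0 leqNgt n0 /=.
  by rewrite gt_eqF // mean_curvature_neq0.
Qed.

(** * Comparison of [H] with [y]: Christoffel symbols, Hessians, Gauss equations *)

Let partial_f_mul (h : 'rV[R]_n -> R) u k : U u -> differentiable h u ->
  partial k (fun v => f v * h v) u = f u * partial k h u.
Proof.
move=> Uu dh; rewrite partialM //; last exact: df.
by rewrite conformal_factor_stationary // mul0r add0r.
Qed.

(** The metric induced by [H] is [f] times that of [y], and the stationary factor passes through the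
    derivatives in Koszul's formula. *)
Lemma conformal_christoffel u i j k : U u ->
  dotp (partial i (partial j H) u) (partial k H u) =
  f u * dotp (partial i (partial j y) u) (partial k y u).
Proof.
move=> Uu; apply: etrans (koszul oU i j k sH Uu) _.
apply: etrans _ (congr1 ( *%R (f u)) (esym (koszul oU i j k sy Uu))).
have e a b c : partial a (fun v => induced_metric H v b c : R) u =
    f u * partial a (fun v => induced_metric y v b c : R) u.
  rewrite -partial_f_mul //; last first.
    exact: smooth_differentiable (smooth_induced_metric oU b c sy) Uu.
  by apply: eq_partial oU Uu _ => v Uv; rewrite mxE Hconf.
have alg (a b c a' b' c' : R) : a = f u * a' -> b = f u * b' -> c = f u * c' ->
    2^-1 * (a + b - c) = f u * (2^-1 * (a' + b' - c')) by move=> -> -> ->; ring.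
exact: alg (e i j k) (e j i k) (e k i j).
Qed.

(** Differentiate [conformal_christoffel] in the direction [l], exchange [j] and [l], and subtract:
    the third derivatives agree by symmetry. The result is a Gauss equation with full second
    derivatives in place of their normal parts. *)
Lemma gauss_flat u i j l k : U u ->
  dotp (partial i (partial j H) u) (partial l (partial k H) u)
  - dotp (partial i (partial l H) u) (partial j (partial k H) u) =
  f u * (dotp (partial i (partial j y) u) (partial l (partial k y) u)
         - dotp (partial i (partial l y) u) (partial j (partial k y) u)).
Proof.
move=> Uu.
have ddH a b : differentiable (partial a (partial b H)) u.
  by exact: smooth_differentiable (smooth_partial a oU (smooth_partial b oU sH)) Uu.
have ddy a b : differentiable (partial a (partial b y)) u.
  by exact: smooth_differentiable (smooth_partial a oU (smooth_partial b oU sy)) Uu.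
have key a b c : dotp (partial c (partial a (partial b H)) u) (partial k H u)
    + dotp (partial a (partial b H) u) (partial c (partial k H) u) =
    f u * (dotp (partial c (partial a (partial b y)) u) (partial k y u)
    + dotp (partial a (partial b y) u) (partial c (partial k y) u)).
  rewrite -(partial_dotp c (ddH a b) (dH k Uu)) -(partial_dotp c (ddy a b) (dy k Uu)).
  rewrite -partial_f_mul //; last by apply: differentiable_dotp => //; exact: dy.
  by apply: eq_partial oU Uu _ => v Uv; exact: conformal_christoffel.
have alg (A B a b c A' a' b' : R) : A + a = f u * (B + b) -> A' + a' = f u * (c + b') ->
  A = A' -> B = c -> a - a' = f u * (b - b').
  by move=> e1 e2 eA eB; subst A c; rewrite -(addKr A' a) e1 -(addKr A' a') e2; ring.
apply: alg (key i j l) (key i l j) _ _.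
  by rewrite (partial3C oU l i j sH Uu).
by rewrite (partial3C oU l i j sy Uu).
Qed.

(* The Hessian of H for the metric induced by y, not by H; the two have the
   same Christoffel symbols by conformal_christoffel. *)
Let hsH i j u : 'rV[R]_m := partial i (partial j H) u
  - \sum_(k < n) christoffel (induced_metric y) k i j u *: partial k H u.

Let hs_orth u i j l : U u -> dotp (hs i j u) (partial l y u) = 0.
Proof. exact: hessian_normal. Qed.

Let hsH_orthH u i j l : U u -> dotp (hsH i j u) (partial l H u) = 0.
Proof.
move=> Uu; rewrite dotpBl dotp_suml; apply/eqP; rewrite subr_eq0; apply/eqP.
apply: etrans (conformal_christoffel i j l Uu) _.
rewrite -(christoffel_metric oU sy imm i j l Uu) mulr_sumr; apply: eq_bigr => k _.
by rewrite dotpZl Hconf // mulrCA.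
Qed.

(** The vectors [partial l H] span the tangent space of [y]: by T T = f, the vector f [partial l y]
    is row [l] of T K. *)
Let hsH_orth u i j l : U u -> dotp (hsH i j u) (partial l y u) = 0.
Proof.
move=> Uu; have : dotp (hsH i j u) (f u *: partial l y u) = 0.
  have -> : f u *: partial l y u = row l (T u) *m K u.
    by rewrite -row_mul KT // mulmxA TT // mul_scalar_mx linearZ /= row_jac.
  by rewrite mul_jac dotp_sumr big1 // => b _; rewrite dotpZr hsH_orthH // mulr0.
by rewrite dotpZr => /eqP; rewrite mulf_eq0 gt_eqF ?f_gt0 //= => /eqP.
Qed.

Let tangent u l : (partial l y u <= J u)%MS.
Proof. by rewrite -row_jac row_sub. Qed.

Let tangentH u l : U u -> (partial l H u <= J u)%MS.
Proof. by move=> Uu; rewrite -row_jac -/(K u) KT // row_mul submxMl. Qed.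

(** Both sides are normal, so only agreement modulo tangent vectors is to be shown. Differentiating
    dH = T dy, the derivative of [T] multiplies tangent vectors, and so do the Christoffel terms; no
    Codazzi equation enters. *)
Let hsH_T u i j : U u -> hsH i j u = \sum_(a < n) T u i a *: hs a j u.
Proof.
move=> Uu; apply/eqP; rewrite -subr_eq0.
set Z := _ - _.
have Zt : (Z <= J u)%MS.
  (* The derivatives are exchanged so that [T] carries the index [i], as in the claim. *)
  have e : partial i (partial j H) u = \sum_(a < n)
      (partial j (fun v => T v i a : R) u *: partial a y u
       + T u i a *: partial a (partial j y) u).
    rewrite (partialC i j oU Uu sH).
    have h v : U v -> partial i H v = \sum_(a < n) T v i a *: partial a y v.
      move=> Uv; rewrite -row_jac -/(K v) KT // row_mul mul_jac.
      by apply: eq_bigr => a _; rewrite mxE.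
    rewrite (eq_partial j oU Uu h) partial_sum => [|a]; last first.
      by apply: differentiable_scale; [exact: dT|exact: dy].
    apply: eq_bigr => a _.
    rewrite (partialC a j oU Uu sy).
    exact: (partial_scale j (dT i a Uu) (dy a Uu)).
  rewrite /Z /hsH e big_split /=.
  have -> : forall (A B C D : 'rV[R]_m), A + B - C - D = A - C - (D - B).
    by move=> A B C D; rewrite opprB addrA [A - C + B]addrAC.
  rewrite -[X in _ - X]sumrB; apply: addmx_sub; last first.
    rewrite eqmx_opp; apply: summx_sub => a _.
    rewrite -scalerBr; apply: scalemx_sub.
    rewrite /hs /hessian addrAC subrr add0r eqmx_opp.
    by apply: summx_sub => k _; exact: scalemx_sub.
  apply: addmx_sub; first by apply: summx_sub => a _; exact: scalemx_sub.
  by rewrite eqmx_opp; apply: summx_sub => k _; apply: scalemx_sub; exact: tangentH.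
have /submxP[c Zc] := Zt.
apply/eqP; rewrite Zc; apply: tangent_normal_eq0 => l.
rewrite -Zc /Z dotpBl hsH_orth // dotp_suml big1 ?subr0 // => a _.
by rewrite dotpZl hs_orth // mulr0.
Qed.

(** Read [p] and [q] as the tangential parts of [A] and [B]. *)
Let dotp_normal_tangent (A B p q : 'rV[R]_m) :
  dotp (A - p) q = 0 -> dotp (B - q) p = 0 ->
  dotp (A - p) (B - q) = dotp A B - dotp p q.
Proof.
rewrite !(dotpBl, dotpBr) => /eqP; rewrite subr_eq0 => /eqP -> /eqP.
rewrite subr_eq0 => /eqP e; rewrite [dotp p B]dotpC e [dotp q p]dotpC.
by ring.
Qed.

(** The tangential parts [ty] and [tH] have the same coefficients in the frames [partial k y] and
    [partial k H], so their inner products are in the ratio [f] and can be subtracted from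
    [gauss_flat]. *)
Let gauss u i j l k : U u ->
  dotp (hsH i j u) (hsH l k u) - dotp (hsH i l u) (hsH j k u) =
  f u * (dotp (hs i j u) (hs l k u) - dotp (hs i l u) (hs j k u)).
Proof.
move=> Uu.
pose ty a b := \sum_(k < n) christoffel (induced_metric y) k a b u *: partial k y u.
pose tH a b := \sum_(k < n) christoffel (induced_metric y) k a b u *: partial k H u.
have tt a b c d : dotp (tH a b) (tH c d) = f u * dotp (ty a b) (ty c d).
  rewrite !dotp_suml mulr_sumr; apply: eq_bigr => p _.
  rewrite !dotp_sumr mulr_sumr; apply: eq_bigr => q _.
  rewrite !(dotpZl, dotpZr) Hconf // mxE.
  move: (dotp _ _) => z; by ring.
have hE a b c d : dotp (hs a b u) (hs c d u) =
    dotp (partial a (partial b y) u) (partial c (partial d y) u) - dotp (ty a b) (ty c d).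
  apply: dotp_normal_tangent; rewrite dotp_sumr big1 // => p _; rewrite dotpZr;
    by apply/eqP; rewrite mulf_eq0; apply/orP; right; apply/eqP; exact: hs_orth.
have SE a b c d : dotp (hsH a b u) (hsH c d u) =
    dotp (partial a (partial b H) u) (partial c (partial d H) u) - dotp (tH a b) (tH c d).
  apply: dotp_normal_tangent; rewrite dotp_sumr big1 // => p _; rewrite dotpZr;
    by apply/eqP; rewrite mulf_eq0; apply/orP; right; apply/eqP; exact: hsH_orthH.
have alg (SS SS' hh hh' EE EE' YY YY' w w' W W' F : R) :
  SS = EE - W -> SS' = EE' - W' -> hh = YY - w -> hh' = YY' - w' ->
  W = F * w -> W' = F * w' -> EE - EE' = F * (YY - YY') -> SS - SS' = F * (hh - hh').
  move=> -> -> -> -> -> -> e.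
  have -> : EE - F * w - (EE' - F * w') = (EE - EE') - F * (w - w') by ring.
  by rewrite e; ring.
exact: (alg _ _ _ _ _ _ _ _ _ _ _ _ _ (SE i j l k) (SE i l j k) (hE i j l k)
  (hE i l j k) (tt i j l k) (tt i l j k) (gauss_flat i j l k Uu)).
Qed.

Lemma conformal_mean_curvature_umbilic u i : U u ->
  partial i H u = - dotp (H u) (H u) *: partial i y u.
Proof.
move=> Uu.
suff e : K u = - dotp (H u) (H u) *: J u.
  by rewrite -row_jac -/(K u) e linearZ /= row_jac.
apply: (shape_umbilic (unitG Uu) (KT Uu) (KK Uu) (KJ_sym Uu) (trT Uu)).
pose S i j := hsH i j u; pose h i j := hs i j u.
have contr : dotp (metric_contraction (g' u) S) (metric_contraction (g' u) S) =
    f u * dotp (metric_contraction (g' u) h) (metric_contraction (g' u) h).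
  apply: (@gauss_contraction _ _ _ (g' u) (T u)).
  (* By symmetry of K J^T one has T^T g' = g' T, so the claim is g' T T = f g'. *)
  - rewrite {1}/T !trmx_mul trmxK -/(T u) g'_sym.
    have -> : J u *m (K u)^T = K u *m (J u)^T by rewrite -KJ_sym // trmx_mul trmxK.
    rewrite -!mulmxA (mulmxA (K u)) (mulmxA (K u *m _)) -/(T u) TT //.
    by rewrite mul_mx_scalar.
  - by move=> a b; exact: hsH_T.
  - by move=> a b c d; exact: gauss.
apply: (@conformal_factor_le R n m (f u) (H u) (metric_contraction (g' u) S)) => //.
- exact: f_gt0.
- rewrite contract_dotp.
  have SH a b : dotp (S a b) (H u) = - (f u * G u a b).
    rewrite dotpBl dotp_suml big1 ?subr0; first exact: HH2.
    by move=> p _; rewrite dotpZl HH1 // mulr0.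
  transitivity (- (f u * \tr (g' u *m G u))).
    rewrite mulr_sumr -sumrN; apply: eq_bigr => a _; rewrite mxE mulr_sumr -sumrN.
    apply: eq_bigr => b _; rewrite SH /G (induced_metricC y u a b).
    by rewrite mulrN mulrCA.
  by rewrite mulVmx ?mxtrace1 ?(induced_metric_unit sy imm Uu) // mulrC.
- by rewrite contr -Hmean // dotpZl dotpZr; ring.
Qed.

End ConformalMeanCurvature.

(** * Changes of charts *)

Lemma invmx_congruence (F : fieldType) p (A B : 'M[F]_p) :
  A \in unitmx -> B \in unitmx ->
  invmx B = A^T *m invmx (A *m B *m A^T) *m A.
Proof.
move=> uA uB; have uAT : A^T \in unitmx by rewrite unitmx_tr.
set E := A *m B *m A^T; set X := _ *m A.
have uE : E \in unitmx by rewrite !unitmx_mul uA uB uAT.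
have XB : X *m B = 1%:M.
  rewrite -[X *m B](mulmxK uAT).
  have -> : X *m B *m A^T = A^T by rewrite /X -!mulmxA (mulmxA A) -/E mulVmx // mulmx1.
  exact: mulmxV.
by rewrite -[RHS](mulmxK uB) XB mul1mx.
Qed.

(** Moves a change of basis from the covariant tensor to the contracting matrix, where
    [invmx_congruence] recognizes the inverse of the transformed metric. *)
Lemma metric_contraction_congruence (R : realType) n m (P A : 'M[R]_n)
    (h : 'I_n -> 'I_n -> 'rV[R]_m) :
  metric_contraction P
    (fun i j => \sum_(a < n) \sum_(b < n) (A i a * A j b) *: h a b) =
  metric_contraction (A^T *m P *m A) h.
Proof.
rewrite /metric_contraction.
under eq_bigr do under eq_bigr do rewrite scaler_sumr.
under eq_bigr do rewrite exchange_big /=.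
rewrite exchange_big /=; apply: eq_bigr => a _.
under eq_bigr do under eq_bigr do rewrite scaler_sumr.
under eq_bigr do rewrite exchange_big /=.
rewrite exchange_big /=; apply: eq_bigr => b _.
rewrite mxE scaler_suml exchange_big /=; apply: eq_bigr => j _.
rewrite mxE mulr_suml scaler_suml; apply: eq_bigr => i _.
by rewrite scalerA [A^T _ _]mxE; congr (_ *: _); ring.
Qed.

Section Reparametrization.
Variables (R : realType) (n m : nat).

Lemma diff_comp_on (W : normedModType R) (V : set 'rV[R]_n)
    (phi : 'rV[R]_n -> 'rV[R]_n) (g h : 'rV[R]_n -> W) u :
  open V -> V u -> (forall v, V v -> h v = g (phi v)) ->
  differentiable phi u -> differentiable g (phi u) ->
  differentiable h u /\ 'd h u = 'd g (phi u) \o 'd phi u :> ('rV[R]_n -> W).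
Proof.
move=> oV Vu hg dphi dg.
have e : \near u, (g \o phi) u = h u.
  by near=> v; rewrite /= hg //; near: v; exact: open_nbhs_nbhs.
have [dh de] := near_differentiable e (differentiable_comp dphi dg).
by split=> //; exact: etrans de (diff_comp dphi dg).
Unshelve. all: by end_near. Qed.

(** [normal_part] is written with the metric of a chart, the right-hand side depends on the tangent
    space only; this is what carries parallelism from one chart to another. *)
Lemma normal_part_eq0 (U : set 'rV[R]_n) (y : 'rV[R]_n -> 'rV[R]_m) u w :
  smooth_on U y -> (forall u, U u -> injective ('d y u)) -> U u ->
  normal_part y u w = 0 <-> (w <= jac y u)%MS.
Proof.
move=> sy imm Uu; split.
  move/eqP; rewrite subr_eq0 => /eqP ->; apply: summx_sub => i _.
  apply: summx_sub => j _; do 2 apply: scalemx_sub.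
  by rewrite -row_jac row_sub.
move=> /submxP[c ->]; apply/eqP; rewrite subr_eq0; apply/eqP.
set G := induced_metric y u.
have uG : G \in unitmx by exact: (induced_metric_unit sy imm Uu).
have sG : (invmx G)^T = invmx G by apply: invmx_sym; exact: induced_metric_sym.
have {1}-> : c = c *m G *m invmx G by rewrite mulmxK.
rewrite mul_jac; apply: eq_bigr => i _.
rewrite mxE scaler_suml; apply: eq_bigr => j _.
rewrite scalerA mulrC -{1}sG mxE; congr (_ * _ *: _).
rewrite /G induced_metric_jac mulmxA mxE /dotp; apply: eq_bigr => a _.
by rewrite !mxE.
Qed.

Variables (U V : set 'rV[R]_n) (phi : 'rV[R]_n -> 'rV[R]_n).
Variables (y z : 'rV[R]_n -> 'rV[R]_m).
Hypothesis oU : open U.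
Hypothesis oV : open V.
Hypothesis sphi : smooth_on V phi.
Hypothesis phiU : forall v, V v -> U (phi v).
Hypothesis sy : smooth_on V y.
Hypothesis sz : smooth_on U z.
Hypothesis yz : forall v, V v -> y v = z (phi v).
Hypothesis imm_y : forall u, V u -> injective ('d y u).
Hypothesis imm_z : forall u, U u -> injective ('d z u).

Let A v : 'M[R]_n := jac phi v.

Lemma partial_comp (W : normedModType R) (g h : 'rV[R]_n -> W) u i : V u ->
  (forall v, V v -> h v = g (phi v)) -> differentiable g (phi u) ->
  partial i h u = \sum_(a < n) A u i a *: partial a g (phi u).
Proof.
move=> Vu hg dg; have dphi := smooth_differentiable sphi Vu.
have [dh e] := diff_comp_on oV Vu hg dphi dg.
rewrite partial_diff // e /= diff_partial //; apply: eq_bigr => a _.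
by rewrite -(partial_diff i dphi) mxE.
Qed.

Lemma jac_comp u : V u -> jac y u = A u *m jac z (phi u).
Proof.
move=> Vu; apply/row_matrixP => i; rewrite row_jac row_mul mul_jac.
rewrite (partial_comp i Vu yz (smooth_differentiable sz (phiU Vu))).
by apply: eq_bigr => a _; rewrite [in RHS]mxE.
Qed.

(** [A u] is a left factor of the metric of [y], which is invertible. *)
Lemma jac_phi_unit u : V u -> A u \in unitmx.
Proof.
move=> Vu; have := induced_metric_unit sy imm_y Vu.
rewrite induced_metric_jac jac_comp // trmx_mul -mulmxA unitmx_mul.
by case/andP.
Qed.

Lemma partial2_comp u i j : V u ->
  partial i (partial j y) u = \sum_(a < n)
    (partial i (fun v => A v j a : R) u *: partial a z (phi u)
    + A u j a *: \sum_(b < n) A u i b *: partial b (partial a z) (phi u)).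
Proof.
move=> Vu.
have dA a : differentiable (fun v => A v j a : R) u.
  have h : smooth_on V (fun v => partial j phi v 0 a).
    by apply: smooth_coord => //; apply: smooth_partial.
  have h' : smooth_on V (fun v => A v j a : R).
    by move=> k; apply: Ck_ext oV _ (h k) => v _; rewrite mxE.
  exact: smooth_differentiable h' Vu.
have dz a : differentiable (partial a z) (phi u).
  exact: smooth_differentiable (smooth_partial a oU sz) (phiU Vu).
have dzphi a : differentiable (fun v => partial a z (phi v)) u.
  have [h _] := diff_comp_on oV Vu (fun v _ => erefl (partial a z (phi v)))
    (smooth_differentiable sphi Vu) (dz a).
  exact: h.
have e v : V v -> partial j y v = \sum_(a < n) A v j a *: partial a z (phi v).
  by move=> Vv; exact: (partial_comp j Vv yz (smooth_differentiable sz (phiU Vv))).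
rewrite (eq_partial i oV Vu e) partial_sum => [|a]; last exact: differentiable_scale.
apply: eq_bigr => a _; rewrite (partial_scale i (dA a) (dzphi a)).
by rewrite (partial_comp i Vu (fun v _ => erefl (partial a z (phi v))) (dz a)).
Qed.

(** Both sides are normal and differ by tangent vectors, so the inhomogeneous term in the
    transformation law of Christoffel symbols is never computed. *)
Lemma hessian_comp u i j : V u ->
  hessian (induced_metric y) y i j u = \sum_(a < n) \sum_(b < n)
    (A u i a * A u j b) *: hessian (induced_metric z) z a b (phi u).
Proof.
move=> Vu; apply/eqP; rewrite -subr_eq0; set Z := _ - _.
have tz a : (partial a z (phi u) <= jac z (phi u))%MS by rewrite -row_jac row_sub.
have ty a : (partial a y u <= jac z (phi u))%MS.
  by rewrite -row_jac jac_comp // row_mul submxMl.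
have tZ : (Z <= jac z (phi u))%MS.
  rewrite /Z {1}/hessian partial2_comp // big_split /=.
  have -> : forall (B C D E : 'rV[R]_m), B + C - D - E = B - D - (E - C).
    by move=> B C D E; rewrite opprB addrA [B - D + C]addrAC.
  rewrite [X in _ - (_ - X)](_ : _ = \sum_(a < n) \sum_(b < n)
      (A u i a * A u j b) *: partial a (partial b z) (phi u)); last first.
    rewrite exchange_big /=; apply: eq_bigr => a _; rewrite scaler_sumr.
    by apply: eq_bigr => b _; rewrite scalerA mulrC.
  apply: addmx_sub.
    apply: addmx_sub; first by apply: summx_sub => a _; exact: scalemx_sub.
    by rewrite eqmx_opp; apply: summx_sub => a _; exact: scalemx_sub.
  rewrite eqmx_opp -sumrB; apply: summx_sub => a _; rewrite -sumrB.
  apply: summx_sub => b _; rewrite -scalerBr; apply: scalemx_sub.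
  rewrite /hessian addrAC subrr add0r eqmx_opp.
  by apply: summx_sub => k _; exact: scalemx_sub.
have /submxP[c Zc] := tZ.
apply/eqP; rewrite Zc; apply: tangent_normal_eq0 => l; rewrite -Zc.
have hz a b : dotp (hessian (induced_metric z) z a b (phi u)) (partial l z (phi u)) = 0.
  exact: (hessian_normal oU sz imm_z a b l (phiU Vu)).
rewrite dotpBl [X in _ - X]dotp_suml [X in _ - X]big1 ?subr0; last first.
  move=> a _; rewrite dotp_suml big1 // => b _; by rewrite dotpZl hz mulr0.
(* In terms of the frame of [y], the normality of the Hessian of [y] applies. *)
have -> : partial l z (phi u) = row l (invmx (A u)) *m jac y u.
  by rewrite jac_comp // mulmxA -row_mul mulVmx ?jac_phi_unit // -row_mul mul1mx row_jac.
rewrite mul_jac dotp_sumr big1 // => k _; rewrite dotpZr.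
by rewrite (hessian_normal oV sy imm_y i j k Vu) mulr0.
Qed.

Lemma hessian_trace_comp u : V u ->
  metric_contraction (invmx (induced_metric y u))
    (fun i j => hessian (induced_metric y) y i j u) =
  metric_contraction (invmx (induced_metric z (phi u)))
    (fun i j => hessian (induced_metric z) z i j (phi u)).
Proof.
move=> Vu; have uA := jac_phi_unit Vu.
have uz := induced_metric_unit sz imm_z (phiU Vu).
have e : invmx (induced_metric z (phi u)) =
    (A u)^T *m invmx (induced_metric y u) *m A u.
  have uy := induced_metric_unit sy imm_y Vu.
  have E : induced_metric y u = A u *m induced_metric z (phi u) *m (A u)^T.
    by rewrite !induced_metric_jac jac_comp // trmx_mul !mulmxA.
  exact: etrans (invmx_congruence uA uz)
    (congr1 (fun M => (A u)^T *m invmx M *m A u) (esym E)).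
pose hz i j := hessian (induced_metric z) z i j (phi u).
apply: etrans _ (congr1 (fun Q => metric_contraction Q hz) (esym e)).
apply: etrans _ (metric_contraction_congruence (invmx (induced_metric y u)) (A u) hz).
by apply: eq_bigr => i _; apply: eq_bigr => j _; rewrite hessian_comp.
Qed.

End Reparametrization.

(** * From vanishing derivatives to constancy *)

Section LocallyConstant.

(** A level set is open, and so is its complement. *)
Lemma connected_locally_constant (T : topologicalType) (B : Type) (F : T -> B) :
  connected [set: T] -> (forall p, \forall q \near p, F q = F p) ->
  forall p q, F q = F p.
Proof.
move=> cT lF p q.
have oF (b : B) : open [set x | F x = b].
  by rewrite openE => x /= Fx; apply: filterS (lF x) => x' e; rewrite /= e.
suff : [set x | F x = F p] = setT by move=> e; have : [set: T] q by []; rewrite -e.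
apply: cT.
- by exists p.
- by exists [set x | F x = F p] => //; rewrite setTI.
- exists [set x | F x = F p]; last by rewrite setTI.
  rewrite -openC openE => x /= Fx; apply: filterS (lF x) => x' e.
  by rewrite /= e.
Qed.

(** Mean value theorem on the segment from [u0] to [u], which stays in a ball inside [U]. *)
Lemma partial_eq0_locally_constant (R : realType) (n : nat) (U : set 'rV[R]_n)
    (g : 'rV[R]_n -> R) u0 : open U -> U u0 ->
  (forall u, U u -> differentiable g u) ->
  (forall u i, U u -> partial i g u = 0) ->
  \forall u \near u0, g u = g u0.
Proof.
move=> oU Uu0 dg pg.
have /nbhs_ballP[r /= r0 rU] : nbhs u0 U by exact: open_nbhs_nbhs.
apply/nbhs_ballP; exists r => //= u u0u.
have inU (t : R) : 0 <= t -> t <= 1 -> U (u0 + t *: (u - u0)).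
  move=> t0 t1; apply: rU; rewrite -ball_normE /= opprD addrA subrr sub0r normrN.
  move: u0u; rewrite -ball_normE /= distrC normrZ ger0_norm //; apply: le_lt_trans.
  by rewrite ler_piMl.
pose phi (t : R) := g (u0 + t *: (u - u0)).
have dphi (t : R) : 0 <= t -> t <= 1 -> is_derive t 1 phi 0.
  move=> t0 t1; have d := dg _ (inU t t0 t1).
  apply: is_derive_eq (is_derive_line d) _.
  rewrite diff_partial // big1 // => i _.
  by rewrite pg ?scaler0 //; exact: inU.
have [t||t _] := @MVT_segment R phi (fun=> 0) 0 1 ler01.
- by rewrite in_itv /= => /andP[/ltW t0 /ltW t1]; exact: dphi.
- apply: derivable_within_continuous => t; rewrite in_itv /= => /andP[t0 t1].
  exact: (@ex_derive _ _ _ _ _ _ _ (dphi t t0 t1)).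
have e : u0 + (u - u0) = u by rewrite addrC subrK.
rewrite mul0r /phi scale1r scale0r addr0 e => /eqP.
by rewrite subr_eq0 => /eqP.
Qed.

End LocallyConstant.

(** * Immersed manifolds *)

Lemma diff_sub_cst (R : realType) (V W : normedModType R) (g : V -> W) (q : W) u X :
  differentiable g u -> 'd (g - cst q : V -> W) u X = 'd g u X.
Proof.
move=> dg; have e0 : 'd (cst q : V -> W) u X = 0 by rewrite diff_cst.
have h := congr1 (fun F => F X) (diffB dg (@differentiable_cst R V W q u)).
exact: etrans h (etrans (congr1 (fun w => 'd g u X - w) e0) (subr0 _)).
Qed.

Lemma diff_homothety (R : realType) (V W : normedModType R) (g : V -> W) (s : R)
    (q : W) u X :
  differentiable g u -> 'd (fun v => s *: (g v - q)) u X = s *: 'd g u X.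
Proof.
move=> dg; have e1 := diff_sub_cst q X dg.
have dB : differentiable (g - cst q : V -> W) u.
  by apply: differentiableB => //; exact: differentiable_cst.
have h : 'd (s *: (g - cst q) : V -> W) u X = s *: 'd (g - cst q : V -> W) u X.
  exact: (congr1 (fun F => F X) (diffZ s dB)).
have -> : (fun v => s *: (g v - q)) = s *: (g - cst q) by [].
by rewrite h; congr (_ *: _).
Qed.

(** The center of the sphere is the constant H + A x divided by A. The hypothesis is coordinatewise
    because constancy is proved for real functions. *)
Lemma homothety_center (R : realType) m (A : R) (h h0 z z0 : 'rV[R]_m) : A != 0 ->
  (forall k, h 0 k + A * z 0 k = h0 0 k + A * z0 0 k) ->
  z - A^-1 *: (h0 + A *: z0) = - (A^-1 *: h).
Proof.
move=> A0 e; apply/rowP => k; rewrite !mxE -e.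
by field.
Qed.


Section ImmersedManifold.
Variables (R : realType) (n m : nat) (M : manifold R n) (x : M -> 'rV[R]_m).
Hypothesis n0 : (0 < n)%N.
Hypothesis hx : immersion x.
Implicit Types (c d : chart R n M).

Let n_neq0 : n%:R != 0 :> R.
Proof. by rewrite pnatr_eq0 -lt0n. Qed.

Let y c := x \o param c.
Let sy c : atlas c -> smooth_on (cimg c) (y c) := hx.1 c.
Let V c d := cimg c `&` param c @^-1` cdom d.
Let tr c d := Defs.coord d \o param c.

Let oV c d : open (V c d).
Proof.
have oc := @cimg_open _ _ _ c.
have /(continuous_inP _ oc) : {in cimg c, continuous (param c)}.
  by rewrite -continuous_open_subspace //; exact: param_continuous.
by apply; exact: cdom_open.
Qed.

Let tr_cimg c d v : V c d v -> cimg d (tr c d v).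
Proof. by move=> [_ dv]; exact: coord_cimg. Qed.

Let V_chart_at c u : cimg c u -> V c (chart_at (param c u)) u.
Proof. by move=> cu; split=> //; exact: mem_chart_at. Qed.

Let y_tr c d v : V c d v -> y c v = y d (tr c d v).
Proof. by move=> [_ dv]; rewrite /y /= coordK. Qed.

Let str c d : atlas c -> atlas d -> smooth_on (V c d) (tr c d).
Proof. exact: atlas_compatible. Qed.

Let V_tr c d u : V c d u -> V d c (tr c d u).
Proof.
move=> Vu; split; first exact: tr_cimg.
by case: Vu => cu du; rewrite /= coordK //; exact: param_cdom.
Qed.

(** Differentiating tr d c o tr c d = id gives a left inverse. *)
Let diff_tr_inj c d u : atlas c -> atlas d -> V c d u -> injective ('d (tr c d) u).
Proof.
move=> ac ad Vu.
have e v : V c d v -> v = tr d c (tr c d v).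
  by move=> [cv dv]; rewrite /tr /= coordK // paramK.
have [_ de] := @diff_comp_on R n _ _ (tr c d) (tr d c) id u (@oV c d) Vu e
  (smooth_differentiable (str ac ad) Vu) (smooth_differentiable (str ad ac) (V_tr Vu)).
apply: (@can_inj _ _ _ ('d (tr d c) (tr c d u))) => v.
have := congr1 (fun F => F v) de; rewrite /= => <-.
by have /= -> := congr1 (fun F => F v) (@diff_val _ _ _ _ _ _ _ (@is_diff_id R _ u)).
Qed.

(** Reduces the differential in any chart to the preferred chart, in which immersion, conformality
    and parallelism are formulated. *)
Lemma diff_dmap c u (f : M -> 'rV[R]_m) X : atlas c -> cimg c u ->
  (forall d, atlas d -> smooth_on (cimg d) (f \o param d)) ->
  'd (f \o param c) u X =
  dmap f (param c u) ('d (tr c (chart_at (param c u))) u X).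
Proof.
move=> ac cu sf; have ad := chart_at_atlas (param c u).
have Vu := V_chart_at cu.
have e v : V c (chart_at (param c u)) v ->
    (f \o param c) v = (f \o param (chart_at (param c u))) (tr c (chart_at (param c u)) v).
  by move=> [_ dv]; rewrite /= coordK.
have [_ de] := diff_comp_on (@oV _ _) Vu e
  (smooth_differentiable (str ac ad) Vu) (smooth_differentiable (sf _ ad) (tr_cimg Vu)).
exact: etrans (congr1 (fun F : 'rV[R]_n -> 'rV[R]_m => F X) de) _.
Qed.

Lemma chart_immersion c u : atlas c -> cimg c u -> injective ('d (y c) u).
Proof.
move=> ac cu v w; rewrite !(diff_dmap _ ac cu hx.1) => /hx.2.
by apply: diff_tr_inj => //; [exact: chart_at_atlas | exact: V_chart_at].
Qed.

Let imm c (ac : atlas c) u (cu : cimg c u) := chart_immersion ac cu.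

Lemma mean_curvature_param c u : atlas c -> cimg c u ->
  mean_curvature x (param c u) =
  n%:R^-1 *: metric_contraction (invmx (induced_metric (y c) u))
    (fun i j => hessian (induced_metric (y c)) (y c) i j u).
Proof.
move=> ac cu; have ad := chart_at_atlas (param c u).
have Vu := V_chart_at cu.
have symV : smooth_on (V c (chart_at (param c u))) (y c).
  by apply: smooth_subset (sy ac) => v [].
have immV v : V c (chart_at (param c u)) v -> injective ('d (y c) v).
  by move=> [cv _]; exact: imm.
rewrite (hessian_trace_comp (@cimg_open _ _ _ _) (@oV _ _) (str ac ad)
  (@tr_cimg _ _) symV (sy ad) (@y_tr _ _) immV (imm ad) Vu).
by [].
Qed.

Lemma smooth_mean_curvature c : atlas c ->
  smooth_on (cimg c) (mean_curvature x \o param c).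
Proof.
move=> ac; have oc := @cimg_open _ _ _ c.
have h : smooth_on (cimg c) (fun u => n%:R^-1 *:
    metric_contraction (invmx (induced_metric (y c) u))
    (fun i j => hessian (induced_metric (y c)) (y c) i j u)).
  apply: smoothZ => //; first exact: smooth_cst.
  apply: smooth_sum => // i _; apply: smooth_sum => // j _; apply: smoothZ => //.
    exact: (smooth_inv_metric oc (sy ac) (imm ac)).
  exact: (smooth_hessian oc (sy ac) (imm ac)).
by move=> k; apply: Ck_ext oc _ (h k) => u cu; rewrite -mean_curvature_param.
Qed.

Lemma laplace_map_mean_curvature p : laplace_map x p = - n%:R *: mean_curvature x p.
Proof.
rewrite /mean_curvature /mean_curvature_in scaleNr scalerA mulfV // scale1r.
by [].
Qed.

Lemma at_chart_cimg (p : M) : cimg (chart_at p) (at_chart p).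
Proof. by apply: coord_cimg; exact: mem_chart_at. Qed.

Lemma param_at_chart (p : M) : param (chart_at p) (at_chart p) = p.
Proof. by apply: coordK; exact: mem_chart_at. Qed.

Lemma trace_induced_metric c u : atlas c -> cimg c u ->
  \sum_(i < n) \sum_(j < n) invmx (induced_metric (y c) u) i j * induced_metric (y c) u i j
  = n%:R.
Proof.
move=> ac cu; rewrite -(mxtrace1 R n) -(mulVmx (induced_metric_unit (sy ac) (imm ac) cu)).
apply: eq_bigr => i _; rewrite mxE; apply: eq_bigr => j _.
by rewrite (induced_metricC (y c) u i j).
Qed.

(** Differentiating |y - q|^2 = r^2 twice gives [h1], then [h2]. Projecting to the sphere thus adds
    (g_ij / r^2) (y - q) to each second derivative, and the metric trace of g is n. Both
    implications rest on this formula. *)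
Lemma mean_curvature_in_sphere (q : 'rV[R]_m) (r : R) p : 0 < r ->
  (forall p, hypersphere q r (x p)) ->
  mean_curvature_in (sphere_tangent_proj q) x p =
  mean_curvature x p + r ^- 2 *: (x p - q).
Proof.
move=> r0 hq; pose c := chart_at p; pose u := at_chart p.
have ac : atlas c by exact: chart_at_atlas.
have cu : cimg c u by exact: at_chart_cimg.
have oc := @cimg_open _ _ _ c.
have yu : y c u = x p by rewrite /y /= param_at_chart.
have dyq v : cimg c v -> differentiable (fun v => y c v - q) v.
  move=> cv; apply: differentiableB; last exact: differentiable_cst.
  exact: smooth_differentiable (sy ac) cv.
have pyq v i : cimg c v -> partial i (fun v => y c v - q) v = partial i (y c) v.
  move=> cv; have dy := smooth_differentiable (sy ac) cv.
  apply: etrans (partialD i dy (differentiable_cst (- q) v)) _.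
  by rewrite partial_cst addr0.
have h1 v i : cimg c v -> dotp (partial i (y c) v) (y c v - q) = 0.
  move=> cv.
  have e : partial i (fun v => dotp (y c v - q) (y c v - q)) v = 0.
    by rewrite (eq_partial (g := fun=> r ^+ 2) i oc cv) ?partial_cst // => w _; exact: hq.
  move: e; rewrite partial_dotp; [|exact: dyq|exact: dyq].
  rewrite pyq // [dotp (y c v - q) _]dotpC -mulr2n => /eqP.
  by rewrite mulrn_eq0 /= => /eqP.
have h2 i j : dotp (partial i (partial j (y c)) u) (y c u - q) = - induced_metric (y c) u i j.
  have dj : differentiable (partial j (y c)) u.
    exact: smooth_differentiable (smooth_partial j oc (sy ac)) cu.
  have e : partial i (fun v => dotp (partial j (y c) v) (y c v - q)) u = 0.
    by rewrite (eq_partial (g := fun=> 0) i oc cu) ?partial_cst // => w cw; exact: h1.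
  move: e; rewrite partial_dotp; [|exact: dj|exact: dyq].
  by rewrite pyq // => /eqP; rewrite addr_eq0 [dotp (partial j (y c) u) _]dotpC mxE => /eqP.
have sff i j : second_ff (sphere_tangent_proj q) (y c) i j u =
    hessian (induced_metric (y c)) (y c) i j u
    + (induced_metric (y c) u i j * r ^- 2) *: (x p - q).
  rewrite /second_ff /sphere_tangent_proj h2 yu.
  have -> : dotp (x p - q) (x p - q) = r ^+ 2 by exact: hq.
  by rewrite mulNr scaleNr opprK addrAC.
rewrite /mean_curvature_in /trace_metric.
under eq_bigr do under eq_bigr do rewrite sff scalerDr scalerA mulrA.
under eq_bigr do rewrite big_split /=.
rewrite big_split /= scalerDr; congr (_ + _).
under eq_bigr do rewrite -scaler_suml -mulr_suml.
rewrite -scaler_suml -mulr_suml trace_induced_metric //.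
by rewrite scalerA mulrA mulVf // mul1r.
Qed.

Lemma connected_partial_eq0 (h : M -> R) : connected [set: M] ->
  (forall c u, atlas c -> cimg c u -> differentiable (h \o param c) u) ->
  (forall c u i, atlas c -> cimg c u -> partial i (h \o param c) u = 0) ->
  forall p q, h q = h p.
Proof.
move=> cM dh ph; apply: connected_locally_constant cM _ => p.
pose c := chart_at p; have ac : atlas c by exact: chart_at_atlas.
have cp : cdom c p by exact: mem_chart_at.
have cc : {for p, continuous (Defs.coord c)}.
  have := @Defs.coord_continuous _ _ _ c.
  by rewrite continuous_open_subspace; [apply; rewrite inE | exact: cdom_open].
have := partial_eq0_locally_constant (@cimg_open _ _ _ c) (coord_cimg cp)
  (fun u cu => dh c u ac cu) (fun u i cu => ph c u i ac cu).
move=> /cc nh; near=> q.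
have cq : cdom c q by near: q; apply: open_nbhs_nbhs; split=> //; exact: cdom_open.
rewrite -{1}(coordK cq) -(coordK cp).
by near: q.
Unshelve. all: by end_near. Qed.

Lemma dmap_jac p X : dmap x p X = X *m jac (y (chart_at p)) (at_chart p).
Proof.
rewrite mul_jac; apply: diff_partial.
exact: smooth_differentiable (sy (chart_at_atlas p)) (at_chart_cimg p).
Qed.

Lemma dmap_homothety (s : R) (q : 'rV[R]_m) p X :
  dmap (fun p => s *: (x p - q)) p X = s *: dmap x p X.
Proof.
have dy := smooth_differentiable (sy (chart_at_atlas p)) (at_chart_cimg p).
transitivity ('d (fun v => s *: (y (chart_at p) v - q)) (at_chart p) X); first by [].
exact: (diff_homothety s q X dy).
Qed.

Lemma minimal_in_hypersphere_conformal : minimal_in_hypersphere x ->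
  conformal_laplace_transformation x /\ parallel_normal x (mean_curvature x).
Proof.
move=> [q [r [r0 [hq hmin]]]].
have H p : mean_curvature x p = - r ^- 2 *: (x p - q).
  have := hmin p; rewrite (mean_curvature_in_sphere p r0 hq) => /eqP.
  by rewrite addr_eq0 scaleNr => /eqP.
split.
  (* Since H = -(x - q) / r^2, the Laplace map -n H is a homothety of [x] with ratio n / r^2. *)
  exists (fun=> n%:R * r ^- 2); split=> [p|p X Y].
    by rewrite mulr_gt0 ?ltr0n // invr_gt0 exprn_gt0.
  have -> : laplace_map x = (fun p => (n%:R * r ^- 2) *: (x p - q)).
    apply/funext => p'; rewrite laplace_map_mean_curvature H scalerA.
    by rewrite mulrNN.
  by rewrite !dmap_homothety dotpZl dotpZr mulrA -expr2.
move=> p X; rewrite /normal_connection.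
have -> : mean_curvature x = (fun p => - r ^- 2 *: (x p - q)) by apply/funext.
rewrite dmap_homothety.
apply/(normal_part_eq0 _ (sy (chart_at_atlas p)) (imm (chart_at_atlas p)) (at_chart_cimg p)).
by apply: scalemx_sub; rewrite dmap_jac submxMl.
Qed.

(** The two charts have the same tangent space, their Jacobians differing by the invertible factor
    of the transition map. *)
Lemma normal_part_chart c u (f : M -> 'rV[R]_m) i : atlas c -> cimg c u ->
  (forall d, atlas d -> smooth_on (cimg d) (f \o param d)) ->
  (forall p X, normal_connection x f p X = 0) ->
  normal_part (y c) u (partial i (f \o param c) u) = 0.
Proof.
move=> ac cu sf hf; have ad := chart_at_atlas (param c u); have Vu := V_chart_at cu.
have := hf (param c u) ('d (tr c (chart_at (param c u))) u (delta_mx 0 i)).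
rewrite /normal_connection -(diff_dmap (delta_mx 0 i) ac cu sf).
rewrite -(partial_diff i (smooth_differentiable (sf c ac) cu)).
move/(normal_part_eq0 _ (sy ad) (imm ad) (tr_cimg Vu)) => h.
apply/(normal_part_eq0 _ (sy ac) (imm ac) cu); apply: submx_trans h _.
have symV : smooth_on (V c (chart_at (param c u))) (y c).
  by apply: smooth_subset (sy ac) => v [].
have immV v : V c (chart_at (param c u)) v -> injective ('d (y c) v).
  by move=> [cv _]; exact: imm.
rewrite (jac_comp (@oV _ _) (str ac ad) (@tr_cimg _ _) (sy ad) (@y_tr _ _) Vu).
have uA := jac_phi_unit (@oV _ _) (str ac ad) (@tr_cimg _ _) symV (sy ad) (@y_tr _ _) immV Vu.
by rewrite -{1}[jac (y _) _](mulKmx uA) submxMl.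
Qed.

Lemma conformal_minimal_in_hypersphere : connected [set: M] ->
  conformal_laplace_transformation x -> parallel_normal x (mean_curvature x) ->
  minimal_in_hypersphere x.
Proof.
move=> cM [rho [rho0 hrho]] hpar.
pose Hc c := mean_curvature x \o param c.
have sH c (ac : atlas c) : smooth_on (cimg c) (Hc c) := smooth_mean_curvature ac.
have sL c : atlas c -> smooth_on (cimg c) (laplace_map x \o param c).
  move=> ac k; have oc := @cimg_open _ _ _ c.
  have h : smooth_on (cimg c) (fun u => - n%:R *: Hc c u).
    by apply: smoothZ => //; [exact: smooth_cst | exact: sH].
  by apply: Ck_ext oc _ (h k) => u cu; rewrite /= laplace_map_mean_curvature.
(* The factor of dH, as the Laplace map is -n H. *)
pose f c u := (rho (param c u) / n%:R) ^+ 2.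
have f0 c u : cimg c u -> 0 < f c u.
  by move=> _; rewrite exprn_gt0 // divr_gt0 ?ltr0n.
have Hm c (ac : atlas c) u : cimg c u -> n%:R *: Hc c u =
    metric_contraction (invmx (induced_metric (y c) u))
    (fun i j => hessian (induced_metric (y c)) (y c) i j u).
  by move=> cu; rewrite /Hc /= mean_curvature_param // scalerA mulfV // scale1r.
have Hp c (ac : atlas c) u i : cimg c u -> normal_part (y c) u (partial i (Hc c) u) = 0.
  by move=> cu; exact: normal_part_chart ac cu smooth_mean_curvature hpar.
have Hconf c (ac : atlas c) u i j : cimg c u ->
    dotp (partial i (Hc c) u) (partial j (Hc c) u) = f c u * induced_metric (y c) u i j.
  move=> cu; have oc := @cimg_open _ _ _ c.
  have dL k : partial k (laplace_map x \o param c) u = - n%:R *: partial k (Hc c) u.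
    have dH := smooth_differentiable (sH c ac) cu.
    rewrite -(partialZ (- n%:R) k dH); apply: eq_partial oc cu _ => v cv.
    by rewrite /= laplace_map_mean_curvature.
  have EL k := etrans (esym (partial_diff k (smooth_differentiable (sL c ac) cu))) (dL k).
  have Ex k := esym (partial_diff k (smooth_differentiable (sy ac) cu)).
  have scale (Li Lj Hi Hj xi xj yi yj : 'rV[R]_m) (t : R) :
      Li = - n%:R *: Hi -> Lj = - n%:R *: Hj -> xi = yi -> xj = yj ->
      dotp Li Lj = t ^+ 2 * dotp xi xj -> dotp Hi Hj = (t / n%:R) ^+ 2 * dotp yi yj.
    move=> -> -> -> ->; rewrite dotpZl dotpZr mulrA mulrNN -expr2 => e.
    by rewrite expr_div_n mulrAC -e mulrAC mulfV ?mul1r // expf_neq0.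
  rewrite mxE; apply: scale (EL i) (EL j) (Ex i) (Ex j) _.
  have := hrho (param c u) ('d (tr c (chart_at (param c u))) u (delta_mx 0 i))
    ('d (tr c (chart_at (param c u))) u (delta_mx 0 j)).
  by rewrite -!(diff_dmap _ ac cu sL) -!(diff_dmap _ ac cu hx.1).
pose a p := dotp (mean_curvature x p) (mean_curvature x p).
have a_gt0 p : 0 < a p.
  have ac := chart_at_atlas p; have cu := at_chart_cimg p.
  have <- : a (param (chart_at p) (at_chart p)) = a p by rewrite param_at_chart.
  exact: (mean_curvature_neq0 n0 (@cimg_open _ _ _ _) (sy ac) (sH _ ac) (imm ac)
    (Hm _ ac) (Hp _ ac) (f0 _) (Hconf _ ac) cu).
have da c u (ac : atlas c) (cu : cimg c u) : differentiable (a \o param c) u.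
  by apply: differentiable_dotp; exact: smooth_differentiable (sH c ac) cu.
have pa c u i (ac : atlas c) (cu : cimg c u) : partial i (a \o param c) u = 0.
  exact: (norm_mean_curvature_stationary n0 (@cimg_open _ _ _ _) (sy ac) (sH _ ac) (imm ac)
    (Hm _ ac) (Hp _ ac) i cu).
have a_cst p q : a q = a p.
  by apply: (connected_partial_eq0 cM) => [c u|c u i]; [exact: da | exact: pa].
have b_cst (k : 'I_m) p q : mean_curvature x q 0 k + a q * x q 0 k =
    mean_curvature x p 0 k + a p * x p 0 k.
  pose b p := mean_curvature x p 0 k + a p * x p 0 k.
  have dHk c u (ac : atlas c) (cu : cimg c u) : differentiable (fun v => Hc c v 0 k : R) u.
    by have [] := diff_coord 0 k (smooth_differentiable (sH c ac) cu).
  have dyk c u (ac : atlas c) (cu : cimg c u) : differentiable (fun v => y c v 0 k : R) u.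
    by have [] := diff_coord 0 k (smooth_differentiable (sy ac) cu).
  have day c u (ac : atlas c) (cu : cimg c u) :
      differentiable (fun v => (a \o param c) v * y c v 0 k : R) u.
    by apply: differentiableM; [exact: da | exact: dyk].
  apply: (connected_partial_eq0 (h := b) cM) => [c u ac cu|c u i ac cu].
    exact: (differentiableD (dHk c u ac cu) (day c u ac cu)).
  apply: etrans (partialD i (dHk c u ac cu) (day c u ac cu)) _.
  rewrite (partialM i (da c u ac cu) (dyk c u ac cu)) pa // mul0r add0r.
  rewrite (partial_coord i 0 k (smooth_differentiable (sH c ac) cu)).
  rewrite (partial_coord i 0 k (smooth_differentiable (sy ac) cu)).
  rewrite (conformal_mean_curvature_umbilic n0 (@cimg_open _ _ _ _) (sy ac) (sH _ ac) (imm ac)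
    (Hm _ ac) (Hp _ ac) (f0 _) (Hconf _ ac) i cu) mxE mulNr.
  exact: addNr.
(* A connected carrier may be empty; any sphere then serves, here the unit sphere at the origin. *)
case: (pselect (exists p : M, True)) => [[p0 _]|noM]; last first.
  exists 0, 1; split; first exact: ltr01.
  by split=> p; case: noM; exists p.
pose A := a p0; have A0 : 0 < A by exact: a_gt0.
pose q := A^-1 *: (mean_curvature x p0 + A *: x p0).
(* Immediate once |H|^2 and H + |H|^2 x are both constant. *)
have Hq p : x p - q = - (A^-1 *: mean_curvature x p).
  apply: homothety_center => [|k]; first by rewrite gt_eqF.
  exact: etrans (congr1 (fun t => mean_curvature x p 0 k + t * x p 0 k) (esym (a_cst p0 p)))
    (b_cst k p0 p).
(* From x - q = -H / A and |H|^2 = A one gets |x - q|^2 = 1 / A. *)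
pose r := (Num.sqrt A)^-1.
have r0 : 0 < r by rewrite invr_gt0 sqrtr_gt0.
have r2 : r ^+ 2 = A^-1 by rewrite /r exprVn sqr_sqrtr // ltW.
have hq p : hypersphere q r (x p).
  rewrite /hypersphere /= Hq dotpNl dotpNr opprK dotpZl dotpZr -/(a p) (a_cst p0 p) -/A r2.
  by rewrite mulVf ?mulr1 // gt_eqF.
exists q, r; split=> //; split=> // p.
rewrite (mean_curvature_in_sphere p r0 hq) Hq r2 invrK scalerN scalerA mulfV ?gt_eqF //.
by rewrite scale1r subrr.
Qed.

End ImmersedManifold.

Theorem theorem1p2 (R : realType) (n m : nat) (hn : (0 < n)%N)
    (M : manifold R n) (hM : connected [set: M])
    (x : M -> 'rV[R]_m) (hx : immersion x) :
  minimal_in_hypersphere x <->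
  conformal_laplace_transformation x /\ parallel_normal x (mean_curvature x).
Proof.
split; first exact: minimal_in_hypersphere_conformal.
by move=> [hc hp]; exact: conformal_minimal_in_hypersphere.
Qed.
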